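(* (Spectral Theorem for normal bounded linear operators) Let $b$ be a normal bounded linear operator on a Hilbert space $H\neq\{0\}$. There is a unique resolution of identity $P$ on $\mathrm{sp}(b)$, acting on $H$, such that $$b=\int_{\mathrm{sp}(b)}\mathrm{id}_{\mathrm{sp}(b)}\,dP\quad\text{(in norm)}.$$ Moreover $\{b\}'=P'$, and the support of $P$ is all of $\mathrm{sp}(b)$.
   Context: Hilbert spaces are complex. $\mathrm{sp}(b)$ is the spectrum of $b$ in $B(H)$, with the topology inherited from $\mathbb{C}$; $\mathrm{id}_{\mathrm{sp}(b)}$ is the identical function $z\mapsto z$ on $\mathrm{sp}(b)$. A spectral measure $P$ defined on a $\sigma$-algebra $\mathcal{E}$ on a set $\Omega\ne\varnothing$ and acting on $H$ is a map $P:\mathcal{E}\to B(H)$ such that each $P(\omega)$ is an orthogonal projection, $P(\Omega)=1$, and $\omega\mapsto\langle P(\omega)x,x\rangle$ is a measure for every $x\in H$. A resolution of identity on a locally compact Hausdorff space $\Omega\neq\varnothing$ is a spectral measure on the Borel $\sigma$-algebra of $\Omega$ such that all measures $\langle Px,x\rangle$ are inner regular ($\mu(\omega)=\sup\{\mu(K):K\subset\omega\text{ compact}\}$). Its support is $\Omega\setminus\omega$, where $\omega$ is the largest open set with $P(\omega)=0$. For a bounded measurable complex function $f$ and $b\in B(H)$, $b=\int f\,dP$ (in norm) means that $\|b-I_P(h)\|\leq|f-h|_\infty$ (supremum norm) for every measurable step function $h$, where $I_P$ is the linear map on step functions with $I_P(1_\omega)=P(\omega)$. $\{b\}'$ is the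 set of operators in $B(H)$ commuting with $b$; $P'$ is the set of operators in $B(H)$ commuting with all $P(\omega)$. *)

(* Defs.v *)
From HB Require Import structures.
From mathcomp Require Import all_boot all_order all_algebra.
From mathcomp Require Import all_classical all_reals all_analysis.
From mathcomp Require Import complex sesquilinear.

Set Implicit Arguments.
Unset Strict Implicit.
Unset Printing Implicit Defensive.

Import Order.TTheory GRing.Theory Num.Theory.
Import numFieldNormedType.Exports.

Local Open Scope classical_set_scope.
Local Open Scope ring_scope.
Local Open Scope complex_scope.

(* The complex field is [R[i]] for a [realType] [R]. A complex Hilbert space is
   a complete normed module [H] over [R[i]] with a positive definite hermitian
   form [ip], linear on the left, such that [hilbert_form ip]. Norms take values
   in [R[i]] (they are real and nonnegative there), so real quantities are
   obtained by applying [complex.Re]. The alias [R[i]^o] is [R[i]] with its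
   usual topology. *)
Definition hilbert_form (R : realType) (H : normedModType R[i])
    (ip : {dot H for Num.conj}) : Prop :=
  forall x : H, `|x| ^+ 2 = ip x x.

Section Operators.
Variables (R : realType) (H : normedModType R[i]).
Implicit Types b c T S : H -> H.

Definition bounded_op : set (H -> H) :=
  [set T | linear T /\ exists M : R, forall x, `|T x| <= M%:C * `|x|].

Definition opnorm T : R :=
  sup [set complex.Re `|T x| | x in [set x : H | `|x| <= 1]].

Definition op_invertible T : Prop :=
  exists2 S, bounded_op S & T \o S = idfun /\ S \o T = idfun.

Definition spectrum b : set R[i]^o :=
  [set z : R[i] | ~ op_invertible (fun x => b x - z *: x)].

Variable ip : {dot H for Num.conj}.

Definition is_adjoint b c : Prop := forall x y, ip (b x) y = ip x (c y).

Definition normal_op b : Prop :=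
  exists c, [/\ bounded_op c, is_adjoint b c & c \o b = b \o c].

Definition orthogonal_projection T : Prop :=
  [/\ bounded_op T, T \o T = T & is_adjoint T T].

End Operators.

(* The library's [{measure set T -> \bar R}] needs a pointed carrier, which the
   spectrum is not a priori; this repeats the axioms of [isMeasure] for a set
   function considered only on [E]. *)
Definition measure_on (R : realType) (Omega : Type) (E : set (set Omega))
    (mu : set Omega -> \bar R) : Prop :=
  [/\ mu set0 = 0%E,
      (forall A, E A -> (0 <= mu A)%E) &
      forall F : (set Omega)^nat, (forall n, E (F n)) -> trivIset setT F ->
        (fun n => (\sum_(0 <= i < n) mu (F i))%E) @ \oo -->
          mu (\bigcup_n F n)].

Definition borel (Omega : topologicalType) : set (set Omega) := <<s open >>.

(* A map defined on a sigma-algebra [E] is represented by a function on all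
   subsets of [Omega] whose values outside [E] are irrelevant. *)
Section SpectralMeasures.
Variables (R : realType) (H : normedModType R[i]).
Variable ip : {dot H for Num.conj}.

Definition spectral_value (Omega : Type) (P : set Omega -> H -> H) (x : H)
    (A : set Omega) : \bar R :=
  (complex.Re (ip (P A x) x))%:E.

Definition spectral_measure (Omega : Type) (E : set (set Omega))
    (P : set Omega -> H -> H) : Prop :=
  [/\ [set: Omega] !=set0,
      sigma_algebra setT E,
      (forall A, E A -> orthogonal_projection ip (P A)),
      P setT = idfun &
      forall x, measure_on E (spectral_value P x)].

Definition resolution_of_identity (Omega : topologicalType)
    (P : set Omega -> H -> H) : Prop :=
  [/\ locally_compact [set: Omega],
      hausdorff_space Omega,
      spectral_measure (@borel Omega) P &
      forall x A, borel A ->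
        spectral_value P x A =
        ereal_sup [set spectral_value P x K |
                   K in [set K | K `<=` A /\ compact K]]].

End SpectralMeasures.

Section SpectralIntegral.
Variables (R : realType) (H : normedModType R[i]) (Omega : Type).
Variables (E : set (set Omega)) (P : set Omega -> H -> H).

Definition measurable_step (h : Omega -> R[i]^o) : Prop :=
  finite_set (range h) /\ forall c, E (h @^-1` [set c]).

Definition bounded_measurable (f : Omega -> R[i]^o) : Prop :=
  bounded_fun f /\ forall U : set R[i]^o, open U -> E (f @^-1` U).

Definition supnorm (f : Omega -> R[i]^o) : R :=
  sup (range (fun z => complex.Re `|f z|)).

(* [I] is the linear map [I_P] on measurable step functions; it is only
   constrained there. *)
Definition is_step_integral (I : (Omega -> R[i]^o) -> H -> H) : Prop :=
  (forall A, E A -> I (\1_A) = P A) /\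
  (forall (a : R[i]) h k, measurable_step h -> measurable_step k ->
     I (a *: h + k) = a *: I h + I k).

Definition is_spectral_integral (f : Omega -> R[i]^o) (b : H -> H) : Prop :=
  [/\ bounded_measurable f, bounded_op b &
      exists2 I, is_step_integral I &
        forall h, measurable_step h -> opnorm (b - I h) <= supnorm (f - h)].

End SpectralIntegral.

Section CommutantsSupport.
Variables (R : realType) (H : normedModType R[i]).

Definition commutant (b : H -> H) : set (H -> H) :=
  [set T | bounded_op T /\ T \o b = b \o T].

Definition spectral_commutant (Omega : Type) (E : set (set Omega))
    (P : set Omega -> H -> H) : set (H -> H) :=
  [set T | bounded_op T /\ forall A, E A -> T \o P A = P A \o T].

Definition null_open (Omega : topologicalType) (P : set Omega -> H -> H) :
    set (set Omega) :=
  [set U | open U /\ P U = 0].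

Definition is_support (Omega : topologicalType) (P : set Omega -> H -> H)
    (S : set Omega) : Prop :=
  exists U, [/\ null_open P U, (forall V, null_open P V -> V `<=` U) &
                S = ~` U].

End CommutantsSupport.

(* Main.v *)
Require Import Defs.
From mathcomp Require Import all_boot all_order all_algebra.
From mathcomp Require Import all_classical all_reals all_analysis.
From mathcomp Require Import complex sesquilinear.
From mathcomp Require Import finmap ring lra.
Import Order.TTheory GRing.Theory Num.Theory.
Import numFieldNormedType.Exports.
Local Open Scope classical_set_scope.
Local Open Scope ring_scope.
Local Open Scope complex_scope.

(** The idea is to find the spectral subspaces of [b] directly, from the geometry of
    the Hilbert space, and to build the measure from them by inner approximation.

    Call an orthogonal projection [p] that commutes with [b] localised in the closed
    disc of centre [z] and radius [e] if [|b p x - z p x| <= e |p x|] for all [x]. Two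
    projections [p] and [q] localised in discs at positive distance satisfy
    [q T p = 0] for every bounded [T] commuting with [b]: on the range of [p] the
    powers of [b - z] grow at most like [e ^ n], on the range of [q] they grow faster
    ([separation]). In particular no information on the adjoint of [b] enters, which
    is why the commutant statement, Fuglede's theorem, comes out directly.

    There are enough localised projections. If [T] is self-adjoint with absolute value
    [s], the square root of [T ^ 2], then the kernel of [s - T] splits the space into a
    part where [T] is positive and one where it is negative ([split_proj]). Applied
    alternately to the real and imaginary parts of [b], shifted to the middle of their
    current range, this bisection writes the identity as a finite sum of projections
    localised in arbitrarily small discs ([partition_exists]).

    The spectral subspace [specsub K] of a set [K] consists of the vectors killed by all
    projections localised in discs that miss [K]. With fine partitions one sees that
    the subspaces of disjoint compact sets are orthogonal, that those of [K] and [L]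
    intersect in that of the intersection, that [b - z] has norm at most [e] on the
    subspace of a set contained in the disc of radius [e] about [z], and that the
    subspace of the spectrum is everything. For an arbitrary set [A] let [innersub A] be
    the closure of the union of the [specsub K] over the compact subsets [K] of [A]. As
    in the construction of a Radon measure from its values on compact sets, the sets [A]
    for which the subspaces of [A] and of its complement together span the space form a
    sigma-algebra containing the closed sets ([splitting_closed],
    [splitting_bigcup]), and on it the projections [specproj A] onto [innersub A] are
    countably additive ([specproj_sigma]). They are the spectral measure; its inner
    regularity is built in.

    For a step function [h] the operator [b - v] is bounded by [sup |id - h|] on the
    subspace of the level set [h = v], and these subspaces are orthogonal, so [b] is the
    integral of the identity. If [Q] is another resolution with this property, then the
    projections [Q A] for small [A] are localised near [A], and [separation] shows that
    [Q] maps into the same spectral subspaces ([range_specsub]); hence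
    uniqueness. *)

Set Implicit Arguments.
Unset Strict Implicit.
Unset Printing Implicit Defensive.

(** * Real inner product and norm *)

Section RealNorm.
Variable R : realType.
Implicit Types z w : R[i].

Definition cabs z : R := complex.Re `|z|.

Lemma cabsE z : `|z| = (cabs z)%:C.
Proof. by rewrite /cabs [in LHS]normc_def normc_def. Qed.

Lemma cabs_ge0 z : 0 <= cabs z.
Proof. by rewrite -ler0c -cabsE. Qed.

Lemma cabsD z w : cabs (z + w) <= cabs z + cabs w.
Proof. by rewrite -lecR rmorphD /= -!cabsE ler_normD. Qed.

Lemma cabsM z w : cabs (z * w) = cabs z * cabs w.
Proof. by apply: complexI; rewrite rmorphM /= -!cabsE normrM. Qed.

Lemma cabsN z : cabs (- z) = cabs z.
Proof. by rewrite /cabs normrN. Qed.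

Lemma cabsC z w : cabs (z - w) = cabs (w - z).
Proof. by rewrite -cabsN opprB. Qed.

Lemma cabs0 : cabs 0 = 0.
Proof. by rewrite /cabs normr0. Qed.

Lemma cabs_real (k : R) : cabs k%:C = `|k|.
Proof. by rewrite /cabs normc_def /= expr0n /= addr0 sqrtr_sqr. Qed.

Lemma cabsi : cabs 'i = 1.
Proof. by rewrite /cabs normc_def /= expr0n expr1n /= add0r sqrtr1. Qed.

Lemma cabs2 z : cabs z ^+ 2 = complex.Re z ^+ 2 + complex.Im z ^+ 2.
Proof. by rewrite /cabs normc_def /= sqr_sqrtr // addr_ge0 // sqr_ge0. Qed.

Lemma ReD z w : complex.Re (z + w) = complex.Re z + complex.Re w.
Proof. by case: z; case: w. Qed.

Lemma ReN z : complex.Re (- z) = - complex.Re z.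
Proof. by case: z. Qed.

Lemma Re_realM (k : R) z : complex.Re (k%:C * z) = k * complex.Re z.
Proof. by case: z => a b /=; rewrite mul0r subr0. Qed.

Lemma cabs_le_tri w z u : cabs (z - u) <= cabs (z - w) + cabs (w - u).
Proof. by rewrite -[X in cabs X](subrKA w) cabsD. Qed.

Section Norm.
Variable H : normedModType R[i].
Implicit Types x y : H.

Definition nm x : R := complex.Re `|x|.

Lemma nmE x : `|x| = (nm x)%:C.
Proof. by rewrite /nm RRe_real // normr_real. Qed.

Lemma nm_ge0 x : 0 <= nm x.
Proof. by rewrite -ler0c -nmE. Qed.

Lemma nmD x y : nm (x + y) <= nm x + nm y.
Proof. by rewrite -lecR rmorphD /= -!nmE ler_normD. Qed.

Lemma nmN x : nm (- x) = nm x.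
Proof. by rewrite /nm normrN. Qed.

Lemma nmC x y : nm (x - y) = nm (y - x).
Proof. by rewrite -nmN opprB. Qed.

Lemma nm0 : nm 0 = 0.
Proof. by rewrite /nm normr0. Qed.

Lemma nm0_eq0 x : nm x = 0 -> x = 0.
Proof. by move=> x0; apply/normr0_eq0; rewrite nmE x0. Qed.

Lemma nmZ (c : R[i]) x : nm (c *: x) = cabs c * nm x.
Proof. by apply: complexI; rewrite rmorphM /= -nmE -cabsE normrZ nmE. Qed.

Lemma nm_tri y x (u : H) : nm (x - u) <= nm (x - y) + nm (y - u).
Proof. by rewrite -[X in nm X](subrKA y) nmD. Qed.

Lemma nmB_ge x y : nm x - nm y <= nm (x - y).
Proof. by rewrite lerBlDr -{1}(subrK y x) nmD. Qed.

Lemma nm_small_eq0 x : (forall e : R, 0 < e -> nm x <= e) -> x = 0.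
Proof.
move=> small; apply: nm0_eq0; apply/eqP; rewrite eq_le nm_ge0 andbT.
by apply/ler_addgt0Pl => e /small; rewrite addr0.
Qed.

End Norm.
End RealNorm.

Lemma conjE (R : realType) (z : R[i]) : Num.conj z = (z^*)%C.
Proof.
have [->|z0] := eqVneq z 0; first by rewrite rmorph0 conjc0.
by apply: (mulfI z0); rewrite -sqr_normc normCK.
Qed.

Section RealInner.
Variables (R : realType) (H : normedModType R[i]).
Variables (ip : {dot H for Num.conj}) (ipE : hilbert_form ip).
Implicit Types x y u v : H.

Definition rip x y : R := complex.Re (ip x y).

Lemma ripDl x y u : rip (x + y) u = rip x u + rip y u.
Proof. by rewrite /rip linearDl ReD. Qed.

Lemma ripC x y : rip x y = rip y x.
Proof.
rewrite /rip hermC expr0 mul1r /= conjE.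
by case: (ip y x).
Qed.

Lemma ripDr u x y : rip u (x + y) = rip u x + rip u y.
Proof. by rewrite ripC ripDl ![rip u _]ripC. Qed.

Lemma ripNl x y : rip (- x) y = - rip x y.
Proof. by rewrite /rip linearNl ReN. Qed.

Lemma ripNr x y : rip x (- y) = - rip x y.
Proof. by rewrite ripC ripNl ripC. Qed.

Lemma rip0l x : rip 0 x = 0.
Proof. by rewrite -[0](subrr x) ripDl ripNl subrr. Qed.

Lemma rip0r x : rip x 0 = 0.
Proof. by rewrite ripC rip0l. Qed.

Lemma ripZl (k : R) x y : rip (k%:C *: x) y = k * rip x y.
Proof. by rewrite /rip linearZl_LR /= Re_realM. Qed.

Lemma ripZr (k : R) x y : rip x (k%:C *: y) = k * rip x y.
Proof. by rewrite ripC ripZl ripC. Qed.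

Lemma ripii x y : rip ('i *: x) ('i *: y) = rip x y.
Proof.
rewrite /rip linearZl_LR /= linearZr_LR /= conjE mulrA.
by rewrite (_ : 'i * _ = 1) ?mul1r //; simpc.
Qed.

Lemma rip_il x y : rip ('i *: x) y = - rip x ('i *: y).
Proof.
rewrite -[rip x _]ripii scalerA -expr2 sqr_i scaleN1r ripNr.
by rewrite opprK.
Qed.

(** A sesquilinear form is determined by its real part, so that all geometry can be done
    with the real inner product [rip] and the real norm [nm]. *)
Lemma ip_rip x y : ip x y = rip x y +i* rip x ('i *: y).
Proof.
rewrite /rip linearZr_LR /= conjE.
by case: (ip x y) => a b /=; simpc.
Qed.

Lemma nm2 x : nm x ^+ 2 = rip x x.
Proof. by rewrite /rip -ipE nmE -rmorphXn. Qed.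

Lemma nmD2 x y : nm (x + y) ^+ 2 = nm x ^+ 2 + 2 * rip x y + nm y ^+ 2.
Proof. by rewrite !nm2 !ripDl !ripDr (ripC y x); ring. Qed.

Lemma nmB2 x y : nm (x - y) ^+ 2 = nm x ^+ 2 - 2 * rip x y + nm y ^+ 2.
Proof. by rewrite nmD2 ripNr nmN mulrN. Qed.

Lemma nm_le x y : nm x ^+ 2 <= nm y ^+ 2 -> nm x <= nm y.
Proof. by rewrite ler_pXn2r // nnegrE nm_ge0. Qed.

Lemma cauchy_schwarz x y : rip x y <= nm x * nm y.
Proof.
have [x0|x0] := eqVneq (nm x) 0.
  by rewrite (nm0_eq0 x0) rip0l nm0 mul0r.
have xp : 0 < nm x by rewrite lt_def x0 nm_ge0.
have := sqr_ge0 (nm ((nm y)%:C *: x - (nm x)%:C *: y)).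
rewrite nmB2 !nmZ !cabs_real !ger0_norm ?nm_ge0 // ripZl ripZr.
set a := nm x in xp *; set b := nm y; set c := rip x y => h.
have [b00|b00] := eqVneq b 0.
  by rewrite /c (nm0_eq0 b00) rip0r b00 mulr0.
have bp : 0 < b by rewrite lt_def b00 nm_ge0.
rewrite -(ler_pM2l (mulr_gt0 xp bp)); lra.
Qed.

Lemma cauchy_schwarzN x y : - rip x y <= nm x * nm y.
Proof. by rewrite -ripNl -(nmN x) cauchy_schwarz. Qed.

Lemma cauchy_schwarz_abs x y : `|rip x y| <= nm x * nm y.
Proof. by rewrite ler_norml cauchy_schwarz andbT lerNl cauchy_schwarzN. Qed.

Lemma rip_eq0 x : (forall y, rip x y = 0) -> x = 0.
Proof. by move=> /(_ x); rewrite -nm2 => /eqP; rewrite sqrf_eq0 => /eqP /nm0_eq0. Qed.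

Lemma rip_inj x y : (forall z, rip x z = rip y z) -> x = y.
Proof.
move=> xy; apply/eqP; rewrite -subr_eq0; apply/eqP/rip_eq0 => z.
by rewrite ripDl ripNl xy subrr.
Qed.

Lemma rip_suml (I : Type) (s : seq I) (F : I -> H) y :
  rip (\sum_(i <- s) F i) y = \sum_(i <- s) rip (F i) y.
Proof.
elim: s => [|i s IH]; first by rewrite !big_nil rip0l.
by rewrite !big_cons ripDl IH.
Qed.

End RealInner.

(** * Closed subspaces and orthogonal projections *)

Lemma lt0_cplx (R : realType) (e : R[i]) :
  0 < e -> exists2 r : R, 0 < r & e = r%:C.
Proof.
move=> e0; exists (complex.Re e).
  by move: e0; rewrite ltcE => /andP[].
by rewrite RRe_real // gtr0_real.
Qed.

Section LinearMaps.
Variables (R : realType) (H : normedModType R[i]) (T : H -> H).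
Hypothesis linT : linear T.

Lemma linop0 : T 0 = 0.
Proof.
by have := linT 1 0 0; rewrite !scale1r addr0 => /(congr1 (+%R^~ (- T 0)));
   rewrite subrr addrK.
Qed.

Lemma linopD x y : T (x + y) = T x + T y.
Proof. by have := linT 1 x y; rewrite !scale1r. Qed.

Lemma linopZ a x : T (a *: x) = a *: T x.
Proof. by have := linT a x 0; rewrite linop0 !addr0. Qed.

Lemma linopN x : T (- x) = - T x.
Proof. by rewrite -scaleN1r linopZ scaleN1r. Qed.

Lemma linopB x y : T (x - y) = T x - T y.
Proof. by rewrite linopD linopN. Qed.

Lemma linop_sum (I : Type) (s : seq I) (F : I -> H) :
  T (\sum_(i <- s) F i) = \sum_(i <- s) T (F i).
Proof.
elim: s => [|i s IH]; first by rewrite !big_nil linop0.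
by rewrite !big_cons linopD IH.
Qed.

End LinearMaps.

Section Projections.
Variables (R : realType) (H : completeNormedModType R[i]).
Variables (ip : {dot H for Num.conj}) (ipE : hilbert_form ip).
Implicit Types (x y u v : H) (M : set H).

Local Notation rip := (rip ip).

Lemma nm_complete (u : nat -> H) :
  (forall e : R, 0 < e -> exists N, forall m n, (N <= m)%N -> (N <= n)%N ->
     nm (u m - u n) < e) ->
  exists l, forall e : R, 0 < e -> exists N, forall n, (N <= n)%N ->
     nm (u n - l) < e.
Proof.
move=> cu.
have /cvg_ex[l /cvgrPdist_lt ul] : cvg (u @ \oo).
  apply/cauchy_cvgP/cauchy_exP => e /lt0_cplx[r r0 ->].
  have [N NP] := cu _ r0; exists (u N).
  exists N => // n /= Nn; rewrite -ball_normE /= nmE ltcR.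
  exact: NP.
exists l => e e0; have [|N _ NP] := ul e%:C; first by rewrite ltcR.
by exists N => n /NP /=; rewrite nmE ltcR nmC.
Qed.

(** Closedness is expressed by approximation in norm, the form in which it is proved and
    used. *)
Definition closed_subspace M : Prop :=
  [/\ M 0, (forall (a : R[i]) x y, M x -> M y -> M (a *: x + y)) &
      forall x, (forall e : R, 0 < e -> exists2 y, M y & nm (x - y) < e) ->
        M x].

Section Subspace.
Variables (M : set H) (cM : closed_subspace M).

Lemma sub0 : M 0. Proof. by case: cM. Qed.

Lemma subZ (a : R[i]) x : M x -> M (a *: x).
Proof. by case: cM => M0 MD _ Mx; rewrite -[_ *: _]addr0; apply: MD. Qed.

Lemma subD x y : M x -> M y -> M (x + y).
Proof. by case: cM => M0 MD _ Mx My; rewrite -[x]scale1r; apply: MD. Qed.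

Lemma subN x : M x -> M (- x).
Proof. by move=> Mx; rewrite -scaleN1r; apply: subZ. Qed.

Lemma subB x y : M x -> M y -> M (x - y).
Proof. by move=> Mx My; apply: subD => //; apply: subN. Qed.

Lemma sub_sum (I : Type) (s : seq I) (F : I -> H) :
  (forall i, M (F i)) -> M (\sum_(i <- s) F i).
Proof.
move=> MF; elim: s => [|i s IH]; first by rewrite big_nil; apply: sub0.
by rewrite big_cons; apply: subD.
Qed.

Lemma sub_closed x :
  (forall e : R, 0 < e -> exists2 y, M y & nm (x - y) < e) -> M x.
Proof. by case: cM => _ _; apply. Qed.

(** A minimising sequence for the distance from [x] to [M] is Cauchy by the
    parallelogram law, and its limit is the foot of the perpendicular. *)
Lemma foot_exists x :
  exists2 m, M m & forall v, M v -> rip (x - m) v = 0.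
Proof.
pose D := [set nm (x - m) | m in M].
have D0 : has_inf D.
  split; first by exists (nm (x - 0)), 0 => //; exact: sub0.
  by exists 0 => _ [m _ <-]; exact: nm_ge0.
pose d := inf D.
have d0 : 0 <= d by apply: lb_le_inf; [case: D0|move=> _ [m _ <-]; exact: nm_ge0].
have dM m : M m -> d <= nm (x - m).
  by move=> Mm; apply: ge_inf; [case: D0|exists m].
have ex n : exists m, M m /\ nm (x - m) < d + n.+1%:R^-1.
  have /inf_adherent - /(_ _ D0)[_ [m Mm <-] h] : (0 : R) < n.+1%:R^-1 by [].
  by exists m.
have [m mP] := choice ex.
have para i j (e : R) : 0 < e -> nm (x - m i) < d + e -> nm (x - m j) < d + e ->
    nm (m i - m j) ^+ 2 <= 8 * d * e + 4 * e ^+ 2.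
  move=> e0 hi hj.
  have hm : d <= nm (x - (2^-1)%:C *: (m i + m j)).
    by apply/dM/subZ/subD; [exact: (mP i).1|exact: (mP j).1].
  have E1 : (x - m j) - (x - m i) = m i - m j.
    by rewrite opprB addrC addrA subrK.
  have E2 : (x - m j) + (x - m i) = (2 : R)%:C *: (x - (2^-1)%:C *: (m i + m j)).
    rewrite scalerBr scalerA -rmorphM divff // scale1r.
    rewrite (_ : (2 : R)%:C = 2) ?rmorph_nat // scaler_nat mulr2n.
    by rewrite addrACA -opprD (addrC (m j)).
  have := nmB2 ipE (x - m j) (x - m i); have := nmD2 ipE (x - m j) (x - m i).
  rewrite E1 E2 nmZ cabs_real.
  have := nm_ge0 (x - m i); have := nm_ge0 (x - m j).
  rewrite ger0_norm //; move: hi hj hm.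
  move: (nm _) (nm _) (nm _) (nm _) (rip _ _) => /= a c f g h.
  nra.
have small (e : R) : 0 < e -> exists2 r : R, 0 < r & 8 * d * r + 4 * r ^+ 2 < e ^+ 2.
  (* For [r <= 1] the left-hand side is at most [(8 * d + 4) * r]. *)
  move=> e0; exists (Num.min 1 (e ^+ 2 / (8 * d + 5))).
    by rewrite lt_min ltr01 divr_gt0 ?exprn_gt0 //; lra.
  set r := Num.min _ _.
  have r1 : r <= 1 by rewrite /r ge_min lexx.
  have r2 : r * (8 * d + 5) <= e ^+ 2.
    by rewrite -ler_pdivlMr ?ge_min ?lexx ?orbT //; lra.
  have r0 : 0 < r by rewrite lt_min ltr01 divr_gt0 ?exprn_gt0 //; lra.
  nra.
have near (r : R) : 0 < r -> exists N, forall n, (N <= n)%N -> nm (x - m n) < d + r.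
  move=> r0; have [N _ NP] := near_infty_natSinv_lt (PosNum r0).
  by exists N => n /NP /= h; apply: (lt_trans (mP n).2); rewrite ltrD2l.
have [l lP] : exists l, forall e : R, 0 < e -> exists N, forall n, (N <= n)%N ->
    nm (m n - l) < e.
  apply: nm_complete => e e0; have [r r0 re] := small _ e0.
  have [N NP] := near _ r0; exists N => i j /NP hi /NP hj.
  rewrite -(ltr_pXn2r (ltn0Sn 1)) ?nnegrE ?nm_ge0 ?(ltW e0) //.
  exact: le_lt_trans (para _ _ _ r0 hi hj) re.
have Ml : M l.
  apply: sub_closed => e /lP[N NP]; exists (m N); first exact: (mP N).1.
  by rewrite nmC NP.
have xl : nm (x - l) <= d.
  apply/ler_addgt0Pl => e e0.
  have [|N1 h1] := near (e / 2); first by lra.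
  have [|N2 h2] := lP (e / 2); first by lra.
  have := h1 _ (leq_maxl N1 N2); have := h2 _ (leq_maxr N1 N2).
  have := nm_tri (m (maxn N1 N2)) x l; lra.
exists l => // v Mv.
pose r := rip (x - l) v; pose q := nm v ^+ 2.
have q0 : 0 <= q by rewrite sqr_ge0.
(* The optimal step is [r / q]; the added [1] keeps the denominator positive. *)
pose t := r / (q + 1).
have : nm (x - l) ^+ 2 <= nm ((x - l) - t%:C *: v) ^+ 2.
  rewrite ler_sqr ?nnegrE ?nm_ge0 //; apply: (le_trans xl).
  by rewrite -addrA -opprD; apply/dM/subD => //; exact: subZ.
rewrite [X in _ <= X](nmB2 ipE) ripZr nmZ cabs_real exprMn real_normK ?num_real //.
rewrite -/r -/q /t.
move=> h; have : 0 <= r ^+ 2 * (- (q + 2)) / (q + 1) ^+ 2.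
  have -> : r ^+ 2 * (- (q + 2)) / (q + 1) ^+ 2 =
    - (2 * (r / (q + 1) * r)) + (r / (q + 1)) ^+ 2 * q by field; lra.
  lra.
rewrite pmulr_lge0 ?invr_gt0 ?exprn_gt0 ?ltr_wpDl // => rq.
apply/eqP; rewrite -sqrf_eq0 eq_le sqr_ge0 andbT; nra.
Qed.

Lemma orthZ x (a : R[i]) v : (forall w, M w -> rip x w = 0) -> M v ->
  rip (a *: x) v = 0.
Proof.
move=> xM Mv; rewrite [a]complexE scalerDl ripDl ripZl xM // mulr0 add0r.
by rewrite mulrC -scalerA ripZl rip_il xM ?oppr0 ?mulr0 //; exact: subZ.
Qed.

Definition projOn x : H :=
  xget 0 [set m | M m /\ forall v, M v -> rip (x - m) v = 0].

Lemma projOnP x : M (projOn x) /\ forall v, M v -> rip (x - projOn x) v = 0.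
Proof.
have [m Mm mP] := foot_exists x.
by apply: (@xgetPex _ 0 [set m | M m /\ forall v, M v -> rip (x - m) v = 0]); exists m.
Qed.

Lemma projOn_in x : M (projOn x).
Proof. by case: (projOnP x). Qed.

Lemma projOn_orth x v : M v -> rip (x - projOn x) v = 0.
Proof. by case: (projOnP x) => _; apply. Qed.

Lemma projOn_uniq x m :
  M m -> (forall v, M v -> rip (x - m) v = 0) -> projOn x = m.
Proof.
move=> Mm mP; apply/eqP; rewrite -subr_eq0; apply/eqP/nm0_eq0/eqP.
rewrite -sqrf_eq0 (nm2 ipE).
have Md : M (projOn x - m) by apply: subB => //; exact: projOn_in.
have := mP _ Md; have := projOn_orth x Md.
move=> h1 h2; have {1}-> : projOn x - m = (x - m) - (x - projOn x).
  by rewrite opprB [RHS]addrC addrA subrK.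
by rewrite ripDl ripNl h1 h2 subrr.
Qed.

Lemma projOn_id x : M x -> projOn x = x.
Proof. by move=> Mx; apply: projOn_uniq => // v _; rewrite subrr rip0l. Qed.

Lemma projOn_eq0 x : (forall v, M v -> rip x v = 0) -> projOn x = 0.
Proof. by move=> xP; apply: projOn_uniq; [exact: sub0|move=> v /xP; rewrite subr0]. Qed.

End Subspace.

(** For complex linear maps, being adjoint for the real inner product is equivalent to
    being adjoint for the complex one. *)
Definition adj (T S : H -> H) := forall x y, rip (T x) y = rip x (S y).

Lemma adj_is_adjoint T S : linear T -> is_adjoint ip T S <-> adj T S.
Proof.
move=> lT; split=> [TS x y|TS x y]; first by rewrite /rip TS.
rewrite !ip_rip TS; congr (_ +i* _).
by rewrite -[LHS]opprK -rip_il -(linopZ lT) TS rip_il opprK.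
Qed.

Section Operators.
Implicit Types (T S p q : H -> H).

Definition comm T S := forall x, T (S x) = S (T x).

Lemma commE T S : comm T S <-> T \o S = S \o T.
Proof.
split=> [TS|TS x]; first by apply/funext => x; exact: TS.
by have := congr1 (@^~ x) TS.
Qed.

Lemma bounded_opE T : bounded_op T <->
  linear T /\ exists2 k : R, 0 <= k & forall x, nm (T x) <= k * nm x.
Proof.
split=> -[lT].
  case=> k kT; split=> //; exists `|k| => // x.
  rewrite -lecR -nmE; apply: (le_trans (kT x)).
  by rewrite nmE -rmorphM lecR ler_wpM2r ?nm_ge0 // ler_norm.
case=> k k0 kT; split=> //; exists k => x.
by rewrite !nmE -rmorphM lecR.
Qed.

Lemma bounded_linear T : bounded_op T -> linear T.
Proof. by case. Qed.

Definition oproj p := [/\ linear p, forall x, p (p x) = p x & adj p p].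

Section Oproj.
Variables (p : H -> H) (pP : oproj p).

Lemma oproj_lin : linear p. Proof. by case: pP. Qed.
Lemma oproj_idem x : p (p x) = p x. Proof. by case: pP. Qed.
Lemma oproj_adj x y : rip (p x) y = rip x (p y). Proof. by case: pP. Qed.

Lemma oproj_rip x : rip (p x) x = nm (p x) ^+ 2.
Proof. by rewrite (nm2 ipE) -[in RHS]oproj_adj oproj_idem. Qed.

Lemma oproj_pyth x : nm x ^+ 2 = nm (p x) ^+ 2 + nm (x - p x) ^+ 2.
Proof. by rewrite (nmB2 ipE) [rip x _]ripC oproj_rip; ring. Qed.

Lemma oproj_nm x : nm (p x) <= nm x.
Proof. by apply: nm_le; rewrite [leRHS]oproj_pyth lerDl sqr_ge0. Qed.

Lemma oproj_compl : oproj (fun x => x - p x).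
Proof.
split=> [a x y|x|x y].
- by rewrite (linopD oproj_lin) (linopZ oproj_lin) scalerBr opprD addrACA.
- by rewrite (linopB oproj_lin) oproj_idem subrr subr0.
- by rewrite ripDl ripDr ripNl ripNr oproj_adj.
Qed.

End Oproj.

Lemma oprojE p : oproj p <-> orthogonal_projection ip p.
Proof.
split=> [pP|[/bounded_opE[lp _] pp /adj_is_adjoint ap]].
  split; last by apply/adj_is_adjoint; [exact: oproj_lin|exact: oproj_adj].
    apply/bounded_opE; split; first exact: oproj_lin.
    by exists 1 => // x; rewrite mul1r; exact: oproj_nm.
  by apply/funext => x /=; exact: oproj_idem.
split=> //; last exact: ap.
by move=> x; have := congr1 (@^~ x) pp.
Qed.

Lemma projOn_oproj M : closed_subspace M -> oproj (projOn M).
Proof.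
move=> cM; split=> [a x y|x|x y].
- apply: projOn_uniq => //; first by case: (cM) => _ MD _; apply: MD; exact: projOn_in.
  move=> v Mv; rewrite opprD addrACA -scalerBr ripDl (orthZ cM) ?projOn_orth ?addr0 //.
  by move=> w; apply: projOn_orth.
- by rewrite projOn_id //; exact: projOn_in.
- have h u w : rip (u - projOn M u) (projOn M w) = 0.
    by apply: projOn_orth => //; apply: projOn_in.
  have := h x y; have := h y x; rewrite !ripDl !ripNl.
  rewrite (ripC ip y) (ripC ip (projOn M y)) => /eqP; rewrite subr_eq0 => /eqP -> /eqP.
  by rewrite subr_eq0 => /eqP.
Qed.

(** Invariance of [M] under the adjoint is invariance of its orthogonal complement. *)
Lemma projOn_comm M T S : closed_subspace M -> linear T -> adj T S ->
  (forall x, M x -> M (T x)) -> (forall x, M x -> M (S x)) ->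
  comm (projOn M) T.
Proof.
move=> cM lT TS MT MS x; apply: projOn_uniq => //.
  by apply: MT; apply: projOn_in.
by move=> v Mv; rewrite -(linopB lT) TS projOn_orth //; exact: MS.
Qed.

End Operators.
End Projections.

(** * The positive square root of the square of a contraction *)

Section SquareRoot.
Variables (R : realType) (H : completeNormedModType R[i]).
Variables (ip : {dot H for Num.conj}) (ipE : hilbert_form ip).
Implicit Types (x y : H).
Local Notation rip := (rip ip).

Lemma nm_scaled_small (v : H) (C : R) :
  (forall e : R, 0 < e -> nm v <= e * C) -> v = 0.
Proof.
move=> h; have C0 : 0 <= C.
  by apply: le_trans (nm_ge0 v) _; rewrite -[C]mul1r h.
apply: nm_small_eq0 => e e0; have e1 : 0 < e / (C + 1) by rewrite divr_gt0 //; lra.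
apply: le_trans (h _ e1) _.
by rewrite mulrAC ler_pdivrMr ?ler_wpM2l ?(ltW e0) //; lra.
Qed.

Variables (T : H -> H) (linT : linear T) (adjT : adj ip T T).
Hypothesis T1 : forall x, nm (T x) <= nm x.

Let u x := x - T (T x).

Let linu : linear u.
Proof.
move=> a x y; rewrite /u !(linopD linT) !(linopZ linT) scalerBr opprD.
by rewrite addrACA.
Qed.

Let nmu x : nm (u x) <= nm x.
Proof.
apply: nm_le; rewrite /u (nmB2 ipE) -adjT -(nm2 ipE).
have := T1 (T x); rewrite -ler_sqr ?nnegrE ?nm_ge0 // => h.
have := sqr_ge0 (nm (T x)); lra.
Qed.

(** With [s = 1 - y] the equation [s ^ 2 = T ^ 2] becomes
    [y = (1 - T ^ 2 + y ^ 2) / 2], which is solved by iteration from [0]. *)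
Fixpoint sqit n : H -> H :=
  if n is m.+1 then fun x => (2^-1 : R)%:C *: (u x + sqit m (sqit m x))
  else fun=> 0.

Fixpoint majit n : R := if n is m.+1 then 2^-1 * (1 + majit m ^+ 2) else 0.

Let t01 n : 0 <= majit n <= 1.
Proof. elim: n => [|n /=]; first by rewrite /= lexx ler01. by nra. Qed.

Let tS n : majit n <= majit n.+1.
Proof. by have /andP[h1 h2] := t01 n; rewrite /=; nra. Qed.

Let sq_lin n : linear (sqit n).
Proof.
elim: n => [|n IH] a x y /=; first by rewrite scaler0 addr0.
rewrite linu !(linopD IH) !(linopZ IH) !scalerDr !scalerA (mulrC _ a).
by rewrite addrACA.
Qed.

Let sq_adj n : adj ip (sqit n) (sqit n).
Proof.
elim: n => [|n IH] x y /=; first by rewrite rip0l rip0r.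
by rewrite ripZl ripZr !(ripDl, ripDr, ripNl, ripNr) !IH !adjT.
Qed.

Let sq_comm S n : linear S -> comm S T -> comm S (sqit n).
Proof.
move=> lS ST; elim: n => [|n IH] x /=; first exact: linop0.
by rewrite (linopZ lS) (linopD lS) (linopB lS) !ST !IH.
Qed.

Let sq_comm2 m n : comm (sqit m) (sqit n).
Proof.
apply: sq_comm => //; move=> x; symmetry.
by apply: sq_comm.
Qed.

Let nm_half x : nm ((2^-1 : R)%:C *: x) = 2^-1 * nm x.
Proof. by rewrite nmZ cabs_real ger0_norm. Qed.

Let sq_bnd n x : nm (sqit n x) <= majit n * nm x.
Proof.
elim: n x => [|n IH] x /=; first by rewrite nm0 mul0r.
rewrite nm_half -mulrA ler_pM2l // mulrDl mul1r.
apply: le_trans (nmD _ _) _; apply: lerD => //; apply: le_trans (IH _) _.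
by rewrite expr2 -mulrA ler_wpM2l //; case/andP: (t01 n).
Qed.

(** The factorisation [y' ^ 2 - y ^ 2 = (y' + y)(y' - y)] of commuting iterates
    makes the scalar iteration a majorant in norm. *)
Let sq_diff n x :
  nm (sqit n.+1 x - sqit n x) <= (majit n.+1 - majit n) * nm x.
Proof.
elim: n x => [|n IH] x.
  by rewrite /= subr0 addr0 expr0n /= addr0 subr0 mulr1 nm_half ler_pM2l.
set d := sqit n.+1 x - sqit n x.
have -> : sqit n.+2 x - sqit n.+1 x =
    (2^-1 : R)%:C *: (sqit n.+1 d + sqit n d).
  have E k z : sqit k.+1 z = (2^-1 : R)%:C *: (u z + sqit k (sqit k z)) by [].
  rewrite (E n.+1) [X in _ - X](E n) -scalerBr; congr (_ *: _).
  rewrite (linopB (sq_lin n.+1)) (linopB (sq_lin n)) (sq_comm2 n n.+1).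
  by rewrite opprD addrACA subrr add0r [RHS]addrA subrK.
rewrite nm_half; have -> : majit n.+2 - majit n.+1 =
   2^-1 * ((majit n.+1 + majit n) * (majit n.+1 - majit n)).
  by rewrite -[majit n.+2]/(2^-1 * (1 + majit n.+1 ^+ 2))
     -{2}[majit n.+1]/(2^-1 * (1 + majit n ^+ 2)); ring.
rewrite -mulrA ler_pM2l // -mulrA mulrDl.
apply: le_trans (nmD _ _) _; apply: lerD; apply: le_trans (sq_bnd _ _) _.
  by rewrite ler_wpM2l ?IH //; case/andP: (t01 n.+1).
by rewrite ler_wpM2l ?IH //; case/andP: (t01 n).
Qed.

Let t_mono m n : (m <= n)%N -> majit m <= majit n.
Proof. by move=> mn; apply: (homo_leq (@lexx _ _) (@le_trans _ _)) mn. Qed.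

Let sq_cauchy m n x : (m <= n)%N ->
  nm (sqit n x - sqit m x) <= (majit n - majit m) * nm x.
Proof.
move=> /subnKC <-; elim: (n - m)%N => [|k IH].
  by rewrite addn0 !subrr nm0 mul0r.
rewrite addnS; apply: le_trans (nm_tri (sqit (m + k) x) _ _) _.
have := sq_diff (m + k) x; lra.
Qed.

Let tlim : R := sup (range majit).

Let has_tlim : has_sup (range majit).
Proof.
split; first by exists (majit 0), 0%N.
by exists 1 => _ [n _ <-]; case/andP: (t01 n).
Qed.

Let t_le n : majit n <= tlim.
Proof. by apply: ub_le_sup; [case: has_tlim|exists n]. Qed.

Let t_adh (e : R) : 0 < e -> exists N, forall n, (N <= n)%N -> tlim - majit n <= e.
Proof.
move=> e0; have [_ [N _ <-] h] := sup_adherent e0 has_tlim.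
by exists N => n /t_mono; rewrite -/tlim in h; lra.
Qed.

Let sq_ex x : exists l, forall e : R, 0 < e -> exists N, forall n, (N <= n)%N ->
     nm (sqit n x - l) < e.
Proof.
apply: nm_complete => e e0.
have d0 : 0 < e / (2 * (nm x + 1)) by rewrite divr_gt0 // mulr_gt0 // ltr_wpDl ?nm_ge0.
have [N NP] := t_adh d0; exists N.
have dE : e / (2 * (nm x + 1)) * nm x < e.
  rewrite mulrAC ltr_pdivrMr ?mulr_gt0 ?ltr_wpDl ?nm_ge0 //.
  by rewrite ltr_pM2l //; have := nm_ge0 x; lra.
have step m n : (N <= m)%N -> (m <= n)%N -> nm (sqit n x - sqit m x) < e.
  move=> Nm mn; apply: le_lt_trans (sq_cauchy _ mn) _; apply: le_lt_trans dE.
  by rewrite ler_wpM2r ?nm_ge0 //; have := NP _ Nm; have := t_le n; lra.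
move=> m n Nm Nn; case/orP: (leq_total m n) => mn; last exact: step.
by rewrite nmC; apply: step.
Qed.

Let sqL x : H := projT1 (cid (sq_ex x)).

Let sqL_unif n x : nm (sqL x - sqit n x) <= (tlim - majit n) * nm x.
Proof.
rewrite /sqL; case: cid => /= l lP; apply/ler_addgt0Pl => e /lP[N NP].
pose k := maxn N n; have := NP k (leq_maxl _ _).
have := sq_cauchy x (leq_maxr N n); rewrite -/k.
have := nm_tri (sqit k x) l (sqit n x); rewrite (nmC l (sqit k x)).
have := ler_wpM2r (nm_ge0 x) (t_le k); lra.
Qed.

Let sqL_near (e : R) : 0 < e ->
  exists n, forall k x, (n <= k)%N -> nm (sqL x - sqit k x) <= e * nm x.
Proof.
move=> /t_adh[N NP]; exists N => k x Nk; apply: le_trans (sqL_unif _ _) _.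
by rewrite ler_wpM2r ?nm_ge0 // NP.
Qed.

Let sqL_lin : linear sqL.
Proof.
move=> a x y; apply/eqP; rewrite -subr_eq0; apply/eqP.
apply: (@nm_scaled_small _ (nm (a *: x + y) + cabs a * nm x + nm y)) => e.
move=> /sqL_near[n nP].
have -> : sqL (a *: x + y) - (a *: sqL x + sqL y) =
   (sqL (a *: x + y) - sqit n (a *: x + y)) -
     (a *: (sqL x - sqit n x) + (sqL y - sqit n y)).
  rewrite (linopD (sq_lin n)) (linopZ (sq_lin n)) scalerBr.
  by rewrite [in RHS]addrACA -opprD opprB addrA subrK.
apply: le_trans (nmD _ _) _; rewrite nmN -addrA mulrDr.
apply: lerD; first exact: nP.
apply: le_trans (nmD _ _) _; rewrite nmZ mulrDr mulrCA.
by apply: lerD; [rewrite ler_wpM2l ?cabs_ge0 ?nP|exact: nP].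
Qed.

Let sqL_adj : adj ip sqL sqL.
Proof.
move=> x y; apply/eqP; rewrite -subr_eq0 -normr_eq0 eq_le normr_ge0 andbT.
apply/ler_addgt0Pl => e e0; rewrite addr0.
pose C := 2 * (nm x * nm y + 1).
have xy0 : 0 <= nm x * nm y by rewrite mulr_ge0 ?nm_ge0.
have C0 : 0 < C by rewrite /C; lra.
have [n nP] := sqL_near (divr_gt0 e0 C0).
have -> : rip (sqL x) y - rip x (sqL y) =
   rip (sqL x - sqit n x) y - rip x (sqL y - sqit n y).
  by rewrite !(ripDl, ripDr, ripNl, ripNr) sq_adj; ring.
apply: le_trans (ler_normB _ _) _.
have h1 := cauchy_schwarz_abs ipE (sqL x - sqit n x) y.
have h2 := cauchy_schwarz_abs ipE x (sqL y - sqit n y).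
have h3 := ler_wpM2r (nm_ge0 y) (nP n x (leqnn _)).
have h4 := ler_wpM2l (nm_ge0 x) (nP n y (leqnn _)).
have : e / C * (2 * (nm x * nm y)) <= e.
  by rewrite mulrAC ler_pdivrMr // ler_wpM2l ?(ltW e0) // /C; lra.
lra.
Qed.

Let sqL_comm S : bounded_op S -> comm S T -> comm S sqL.
Proof.
move=> /bounded_opE[lS [k k0 kS]] ST x; apply/eqP; rewrite -subr_eq0; apply/eqP.
apply: (@nm_scaled_small _ (2 * (k * nm x))) => e e0; have [n nP] := sqL_near e0.
have -> : S (sqL x) - sqL (S x) =
   S (sqL x - sqit n x) - (sqL (S x) - sqit n (S x)).
  by rewrite (linopB lS) (sq_comm _ lS ST) [in RHS]opprB addrA subrK.
apply: le_trans (nmD _ _) _; rewrite nmN.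
have h1 := kS (sqL x - sqit n x); have h2 := nP n (S x) (leqnn _).
have h3 := ler_wpM2l k0 (nP n x (leqnn _)).
have h4 := ler_wpM2l (ltW e0) (kS x); lra.
Qed.

Let sqL_bnd x : nm (sqL x) <= nm x.
Proof.
have := sqL_unif 0 x; rewrite /= !subr0 => /le_trans; apply.
rewrite -[leRHS]mul1r ler_wpM2r ?nm_ge0 //; apply: ge_sup; first by case: has_tlim.
by move=> _ [n _ <-]; case/andP: (t01 n).
Qed.

Let sqL_eq x : (2 : R)%:C *: sqL x = u x + sqL (sqL x).
Proof.
apply/eqP; rewrite -subr_eq0; apply/eqP.
apply: (@nm_scaled_small _ (4 * nm x)) => e e0; have [n nP] := sqL_near e0.
have -> : (2 : R)%:C *: sqL x - (u x + sqL (sqL x)) =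
   (2 : R)%:C *: (sqL x - sqit n.+1 x) -
   ((sqL (sqL x) - sqit n (sqL x)) + sqit n (sqL x - sqit n x)).
  rewrite (linopB (sq_lin n)) scalerBr /= scalerA -rmorphM divff // scale1r.
  rewrite [_ - _ + (_ - _)]addrA subrK opprB -[RHS]addrA; congr (_ + _).
  by rewrite !opprD -[RHS]addrA addKr.
apply: le_trans (nmD _ _) _; rewrite nmN nmZ cabs_real ger0_norm //.
have h1 := nP n.+1 x (leqnSn _).
have h2 := nP n (sqL x) (leqnn _).
have h3 := nmD (sqL (sqL x) - sqit n (sqL x)) (sqit n (sqL x - sqit n x)).
have h4 := ler_wpM2l (ltW e0) (sqL_bnd x).
have h5 := sq_bnd n (sqL x - sqit n x).
have h6 := ler_wpM2r (nm_ge0 (sqL x - sqit n x)) (andP (t01 n)).2.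
have h7 := nP n x (leqnn _).
lra.
Qed.

(** The iteration is bounded by the scalar iteration [majit], which increases to a limit at
    most [1]; hence it converges in norm, and its limit [y] satisfies [|y| <= 1], so that
    [s = 1 - y] is positive. *)
Lemma sqrt_exists : exists s, [/\ linear s, adj ip s s,
  (forall x, s (s x) = T (T x)), (forall x, 0 <= rip (s x) x) &
  forall S, bounded_op S -> comm S T -> comm S s].
Proof.
exists (fun x => x - sqL x); split.
- by move=> a x y; rewrite sqL_lin scalerBr opprD addrACA.
- by move=> x y; rewrite !(ripDl, ripDr, ripNl, ripNr) sqL_adj.
- move=> x; have := sqL_eq x.
  rewrite (_ : (2 : R)%:C = 2) ?rmorph_nat // scaler_nat mulr2n => LE.
  rewrite (linopB sqL_lin) opprB addrACA -opprD LE opprD addrACA subrr addr0.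
  by rewrite /u subKr.
- move=> x; rewrite ripDl ripNl subr_ge0 -(nm2 ipE).
  apply: le_trans (cauchy_schwarz ipE _ _) _.
  by rewrite expr2 ler_wpM2r ?nm_ge0.
- move=> S bS ST x; have [lS _] := (bounded_opE S).1 bS.
  by rewrite (linopB lS) (sqL_comm bS ST).
Qed.

End SquareRoot.

(** * Splitting a self-adjoint operator at zero *)

Section SplitProjection.
Variables (R : realType) (H : completeNormedModType R[i]).
Variables (ip : {dot H for Num.conj}) (ipE : hilbert_form ip).
Implicit Types (x y : H).
Local Notation rip := (rip ip).

Lemma ker_closed (D : H -> H) : bounded_op D -> closed_subspace [set x | D x = 0].
Proof.
move=> /bounded_opE[lD [k k0 kD]]; split => [|a x y /= Dx Dy|x /= xD].
- exact: linop0.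
- by rewrite (linopD lD) (linopZ lD) Dx Dy scaler0 addr0.
- apply: (@nm_scaled_small _ _ _ k) => e /xD[y Dy xy].
  rewrite -[D x]subr0 -Dy -(linopB lD) mulrC.
  by apply: le_trans (kD _) _; rewrite ler_wpM2l // ltW.
Qed.

Lemma oproj_bounded p : oproj ip p -> bounded_op p.
Proof. by case/(oprojE ipE). Qed.

(** Positivity of [s] at the vector [y - s y] gives [s ^ 2 <= s]. *)
Lemma contraction_sub_half (s : H -> H) y : linear s -> adj ip s s ->
  (forall x, 0 <= rip (s x) x) -> (forall x, nm (s x) <= nm x) ->
  nm (s y - (2^-1 : R)%:C *: y) <= 2^-1 * nm y.
Proof.
move=> ls as_ s0 s1; rewrite -ler_sqr ?nnegrE ?nm_ge0 ?mulr_ge0 ?nm_ge0 //.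
rewrite (nmB2 ipE) ripZr nmZ cabs_real ger0_norm // !exprMn.
suff : nm (s y) ^+ 2 <= rip (s y) y by lra.
have := s0 (y - s y).
rewrite (linopB ls) !(ripDl, ripDr, ripNl, ripNr) [rip (s (s y)) y]as_.
have := cauchy_schwarz ipE (s (s y)) (s y); have := ler_wpM2r (nm_ge0 (s y)) (s1 (s y)).
rewrite -(nm2 ipE) -expr2; lra.
Qed.

(** With [s] the absolute value of [T] on the range of [p], the operator [T] coincides
    with [s] on the kernel of [s - T] and with [- s] on its orthogonal complement. Its
    values on the two pieces of [p] thus lie in the intervals of radius [r / 2] about
    [r / 2] and [- r / 2]. *)
Lemma split_proj (T p : H -> H) (r : R) :
  bounded_op T -> adj ip T T -> oproj ip p -> comm p T -> 0 < r ->
  (forall x, nm (T (p x)) <= r * nm (p x)) ->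
  exists e0 e1, [/\ oproj ip e0 /\ oproj ip e1,
    (forall x, p x = e0 x + e1 x) /\
      ((forall x, p (e0 x) = e0 x) /\ (forall x, p (e1 x) = e1 x)),
    (forall x, nm (T (e0 x) - (r / 2)%:C *: e0 x) <= r / 2 * nm (e0 x)),
    (forall x, nm (T (e1 x) + (r / 2)%:C *: e1 x) <= r / 2 * nm (e1 x)) &
    forall S S', bounded_op S -> bounded_op S' -> adj ip S S' ->
      comm S T -> comm S p -> comm S' T -> comm S' p ->
      comm e0 S /\ comm e1 S].
Proof.
move=> bT aT pP pT r0 Tr.
have [lT [kT kT0 kTP]] := (bounded_opE T).1 bT.
have lp := oproj_lin pP.
pose T' x := (r^-1)%:C *: T (p x).
have lT' : linear T'.
  by move=> a x y; rewrite /T' (linopD lp) (linopZ lp) (linopD lT) (linopZ lT)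
    scalerDr !scalerA mulrC.
have aT' : adj ip T' T'.
  by move=> x y; rewrite /T' ripZl ripZr aT (oproj_adj pP) pT.
have nT' x : nm (T' x) <= nm x.
  rewrite nmZ cabs_real ger0_norm ?invr_ge0 ?(ltW r0) // ler_pdivrMl //.
  by apply: le_trans (Tr _) _; rewrite ler_wpM2l ?(ltW r0) ?(oproj_nm ipE pP).
have bT' : bounded_op T'.
  by apply/bounded_opE; split=> //; exists 1 => // x; rewrite mul1r.
have commT' S : linear S -> comm S T -> comm S p -> comm S T'.
  by move=> lS ST Sp x; rewrite /T' (linopZ lS) ST Sp.
have [s [ls as_ ss s0 sS]] := sqrt_exists ipE lT' aT' nT'.
have sT' : comm s T' by move=> x; symmetry; exact: sS.
have s1 x : nm (s x) <= nm x.
  by apply: le_trans (nT' x); apply: nm_le; rewrite !(nm2 ipE) as_ ss aT'.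
have bs : bounded_op s.
  by apply/bounded_opE; split=> //; exists 1 => // x; rewrite mul1r.
pose D x := s x - T' x.
have bD : bounded_op D.
  apply/bounded_opE; split.
    by move=> a x y; rewrite /D (linopD ls) (linopZ ls) lT' scalerBr opprD addrACA.
  exists 2 => // x; apply: le_trans (nmD _ _) _; rewrite nmN.
  by have := s1 x; have := nT' x; lra.
pose N := [set x | D x = 0].
have cN : closed_subspace N := ker_closed bD.
pose E := projOn ip N.
have EP : oproj ip E := projOn_oproj ipE cN.
have commE S S' : bounded_op S -> bounded_op S' -> adj ip S S' ->
    comm S T' -> comm S' T' -> comm E S.
  move=> bS bS' aSS ST S'T; have [lS _] := (bounded_opE S).1 bS.
  have [lS' _] := (bounded_opE S').1 bS'.
  apply: (projOn_comm ipE cN lS aSS) => x; rewrite /N /D /= => Nx.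
    by rewrite -(sS S bS ST) -ST -(linopB lS) Nx linop0.
  by rewrite -(sS S' bS' S'T) -S'T -(linopB lS') Nx linop0.
have bp := oproj_bounded pP.
have pp : comm p p by [].
have pT' : comm p T' := commT' _ lp pT pp.
have Ep : comm E p := commE _ _ bp bp (oproj_adj pP) pT' pT'.
have lE := oproj_lin EP.
have TE y : p y = y -> T y = (r : R)%:C *: T' y.
  by move=> py; rewrite /T' py scalerA -rmorphM divff ?scale1r // gt_eqF.
have scaled y v : p y = y -> nm (T' y - v) <= 2^-1 * nm y ->
    nm (T y - (r : R)%:C *: v) <= r / 2 * nm y.
  move=> /TE ->; rewrite -scalerBr nmZ cabs_real ger0_norm ?(ltW r0) // -mulrA.
  by rewrite ler_pM2l.
have pE0 x : p (E (p x)) = E (p x) by rewrite -Ep (oproj_idem pP).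
have pE1 x : p (p x - E (p x)) = p x - E (p x).
  by rewrite (linopB lp) pE0 (oproj_idem pP).
exists (fun x => E (p x)), (fun x => p x - E (p x)); split.
- split.
    split=> [a x y|x|x y].
    + by rewrite (linopD lp) (linopZ lp) (linopD lE) (linopZ lE).
    + by rewrite pE0 (oproj_idem EP).
    + by rewrite (oproj_adj EP) (oproj_adj pP) Ep.
  split=> [a x y|x|x y].
  + by rewrite (linopD lp) (linopZ lp) (linopD lE) (linopZ lE) scalerBr opprD addrACA.
  + by rewrite pE1 (linopB lE) (oproj_idem EP) subrr subr0.
  + rewrite !(ripDl, ripDr, ripNl, ripNr) (oproj_adj EP) (oproj_adj pP).
    by rewrite (oproj_adj pP) Ep.
- by split=> [x|]; [rewrite addrC subrK|split].
- move=> x; rewrite rmorphM /= -scalerA; apply: scaled => //.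
  have : N (E (p x)) by apply: projOn_in.
  by rewrite /N /= /D => /eqP; rewrite subr_eq0 => /eqP <-; apply: contraction_sub_half.
- move=> x; set y := p x - E (p x).
  have yN v : N v -> rip y v = 0 by apply: projOn_orth.
  (* [s + T'] maps into the kernel of [s - T'] because [s ^ 2 = T' ^ 2]. *)
  have DN v : D (s v + T' v) = 0.
    rewrite /D (linopD ls) (linopD lT') ss sT'.
    by rewrite [X in _ - X]addrC subrr.
  have Ny : s y + T' y = 0.
    apply: nm0_eq0; apply/eqP; rewrite -sqrf_eq0 (nm2 ipE); apply/eqP.
    by rewrite ripDl as_ aT' -ripDr yN //; exact: DN.
  have -> : T y + (r / 2)%:C *: y = T y - (r : R)%:C *: (- ((2^-1 : R)%:C *: y)).
    by rewrite scalerN opprK scalerA -rmorphM.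
  apply: scaled; first exact: pE1.
  rewrite opprK (_ : T' y = - s y); last by apply/eqP; rewrite -addr_eq0 addrC Ny.
  by rewrite -nmN opprD opprK contraction_sub_half.
- move=> S S' bS bS' aSS ST Sp S'T S'p.
  have [lS _] := (bounded_opE S).1 bS.
  have [lS' _] := (bounded_opE S').1 bS'.
  have ES : comm E S.
    exact: commE S S' bS bS' aSS (commT' _ lS ST Sp) (commT' _ lS' S'T S'p).
  by split=> x; [rewrite -Sp ES|rewrite -Sp ES (linopB lS)].
Qed.

End SplitProjection.

(** * Approximate spectral partitions of a normal operator *)

Section Localization.
Variables (R : realType) (H : completeNormedModType R[i]).
Variables (ip : {dot H for Num.conj}) (ipE : hilbert_form ip).
Variables (b c : H -> H).
Hypotheses (bb : bounded_op b) (bc : bounded_op c) (abc : adj ip b c).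
Hypothesis cbc : comm c b.
Implicit Types (x y : H) (z w : R[i]) (p q T : H -> H).
Local Notation rip := (rip ip).

(** Localisation of [b] near a point: on the range of the reducing projection [p]
    the operator [b] is within [e] of the scalar [z], so that [p] plays the
    part of a spectral projection of the closed disc of radius [e] about [z]. *)
Definition localized z (e : R) p :=
  [/\ oproj ip p, comm p b & forall x, nm (b (p x) - z *: p x) <= e * nm (p x)].

Lemma adj_sym T S : adj ip T S -> adj ip S T.
Proof. by move=> TS x y; rewrite ripC -TS ripC. Qed.

Lemma comm_adj T p : oproj ip p -> adj ip b T -> comm p b -> comm p T.
Proof.
move=> pP bT pb x; apply: (rip_inj (ip := ip) ipE) => y.
by rewrite (oproj_adj pP) ![rip (T _) _]ripC -!bT -pb (oproj_adj pP).
Qed.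

Lemma oproj0 : oproj ip (fun=> 0).
Proof. by split=> [a x y||x y]; rewrite ?scaler0 ?addr0 ?rip0l ?rip0r. Qed.

(** Iterating [b - z], which shrinks the range of [p] at rate [e] and expands the
    range of [q] at rate [|z - w| - d > e], leaves no room for a nonzero
    [q T p]. *)
Lemma separation z w (e d : R) p q T : localized z e p -> localized w d q ->
  bounded_op T -> comm T b -> 0 <= e -> e + d < cabs (z - w) ->
  forall x, q (T (p x)) = 0.
Proof.
move=> [pP pb pe] [qP qb qd] /bounded_opE[lT [k k0 kT]] Tb e0 ed x.
pose a := cabs (z - w) - d; have ea : e < a by rewrite /a; lra.
have a0 : 0 < a by lra.
have lq := oproj_lin qP; have lp := oproj_lin pP.
have expand y : a * nm (q y) <= nm (b (q y) - z *: q y).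
  have h1 := qd y.
  have h2 := nmB_ge ((z - w) *: q y) ((b (q y) - w *: q y)).
  rewrite nmZ in h2.
  have E3 : (z - w) *: q y - (b (q y) - w *: q y) = - (b (q y) - z *: q y).
    by rewrite scalerBl !opprB addrA subrK.
  rewrite E3 nmN in h2; rewrite /a; lra.
have step n y : a ^+ n * nm (q (T (p y))) <= k * (e ^+ n * nm (p y)).
  elim: n y => [|n IH] y.
    rewrite !expr0 !mul1r; apply: le_trans (kT _).
    exact: (oproj_nm ipE qP).
  rewrite exprSr -mulrA; apply: (@le_trans _ _ (a ^+ n * nm (q (T (p (b y - z *: y)))))).
    apply: ler_wpM2l; first by rewrite exprn_ge0 // ltW.
    by rewrite (linopB lp) (linopZ lp) (linopB lT) (linopZ lT) (linopB lq) (linopZ lq)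
      pb Tb qb expand.
  apply: le_trans (IH _) _; rewrite ler_wpM2l // exprSr -mulrA.
  rewrite ler_wpM2l ?exprn_ge0 //.
  by rewrite (linopB lp) (linopZ lp) pb pe.
apply: (@nm_small_eq0 _ _) => r r0.
have [t0|tn] := eqVneq (nm (q (T (p x)))) 0; first by rewrite t0 ltW.
have rho : `|e / a| < 1.
  by rewrite ger0_norm ?divr_ge0 ?(ltW a0) // ltr_pdivrMr // mul1r.
have /cvgrPdist_lt := @cvg_expr R _ rho.
pose C := k * nm (p x) + 1.
have C0 : 0 < C by rewrite ltr_wpDl // mulr_ge0 ?nm_ge0.
move=> /(_ (r / C) (divr_gt0 r0 C0))[N _ /(_ N (leqnn N))] /=.
rewrite sub0r normrN => /ltW h.
have := le_trans (ler_norm _) h; rewrite expr_div_n ler_pdivrMr ?exprn_gt0 // => h2.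
have kp : 0 <= k * nm (p x) by rewrite mulr_ge0 ?nm_ge0.
have hr : r / C * (k * nm (p x)) <= r.
  by rewrite mulrAC ler_pdivrMr // ler_wpM2l ?(ltW r0) // /C; lra.
have aN : 0 < a ^+ N by rewrite exprn_gt0.
have h3 := step N x; have h4 := ler_wpM2r kp h2; have h5 := ler_wpM2l (ltW aN) hr.
by rewrite -(ler_pM2l aN); lra.
Qed.

End Localization.

Section Partition.
Variables (R : realType) (H : completeNormedModType R[i]).
Variables (ip : {dot H for Num.conj}) (ipE : hilbert_form ip).
Variables (b c : H -> H).
Hypotheses (bb : bounded_op b) (bc : bounded_op c) (abc : adj ip b c).
Hypothesis cbc : comm c b.
Implicit Types (x y : H) (z w : R[i]) (p q T : H -> H).
Local Notation rip := (rip ip).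
Local Notation localized := (localized ip b).

Let linb : linear b := bounded_linear bb.
Let linc : linear c := bounded_linear bc.

Definition realpart x := (2^-1 : R)%:C *: (b x + c x).
Definition imagpart x := (2^-1 : R)%:C *: ('i *: (c x - b x)).

Lemma parts_sum x : b x = realpart x + 'i *: imagpart x.
Proof.
have -> : 'i *: imagpart x = (2^-1 : R)%:C *: (b x - c x).
  by rewrite /imagpart !scalerA mulrAC -expr2 sqr_i mulN1r scaleNr -scalerN opprB.
rewrite /realpart -scalerDr addrACA subrr addr0 -mulr2n -[b x *+ 2]scaler_nat scalerA.
by rewrite -(rmorph_nat (real_complex R) 2) -rmorphM /= mulVf ?scale1r // pnatr_eq0.
Qed.

Lemma bounded_opD S T : bounded_op S -> bounded_op T ->
  bounded_op (fun x => S x + T x).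
Proof.
move=> /bounded_opE[lS [k k0 kS]] /bounded_opE[lT [l l0 lT']].
apply/bounded_opE; split; first by move=> a x y; rewrite lS lT scalerDr addrACA.
exists (k + l) => [|x]; first exact: addr_ge0.
by apply: le_trans (nmD _ _) _; rewrite mulrDl lerD.
Qed.

Lemma bounded_opZ a S : bounded_op S -> bounded_op (fun x => a *: S x).
Proof.
move=> /bounded_opE[lS [k k0 kS]].
apply/bounded_opE; split.
  by move=> d x y; rewrite lS scalerDr !scalerA mulrC.
exists (cabs a * k) => [|x]; first by rewrite mulr_ge0 ?cabs_ge0.
by rewrite nmZ -mulrA ler_wpM2l ?cabs_ge0.
Qed.

Lemma bounded_opN S : bounded_op S -> bounded_op (fun x => - S x).
Proof. by move=> /(bounded_opZ (-1)); under eq_fun do rewrite scaleN1r. Qed.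

Lemma bounded_op_id : bounded_op (fun x : H => x).
Proof. by apply/bounded_opE; split=> //; exists 1 => // x; rewrite mul1r. Qed.

Lemma bounded_op0 : bounded_op (fun x : H => 0 : H).
Proof.
apply/bounded_opE; split; first by move=> a x y; rewrite scaler0 addr0.
by exists 0 => // x; rewrite nm0 mul0r.
Qed.

(** What bisection requires of the real and imaginary parts of [b], among it that they
    commute with every projection reducing [b]. *)
Definition self_part T := [/\ bounded_op T, adj ip T T, comm b T, comm c T &
  forall p, oproj ip p -> comm p b -> comm p T].

Lemma realpart_self : self_part realpart.
Proof.
split.
- by apply: bounded_opZ; apply: bounded_opD.
- move=> x y; rewrite /realpart ripZl ripZr ripDl ripDr abc.
  by rewrite (adj_sym abc) addrC.
- by move=> x; rewrite /realpart (linopZ linb) (linopD linb) cbc.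
- by move=> x; rewrite /realpart (linopZ linc) (linopD linc) cbc.
- move=> p pP pb x; have lp := oproj_lin pP.
  by rewrite /realpart (linopZ lp) (linopD lp) pb (comm_adj ipE pP abc pb).
Qed.

Lemma imagpart_self : self_part imagpart.
Proof.
split.
- apply: bounded_opZ; apply: bounded_opZ; apply: bounded_opD => //.
  exact: bounded_opN.
- move=> x y; rewrite /imagpart ripZl ripZr rip_il ripDl ripNl abc (adj_sym abc).
  by rewrite (linopZ linb) (linopZ linc) opprB -ripNr -ripDr -scalerBr.
- by move=> x; rewrite /imagpart !(linopZ linb) (linopB linb) cbc.
- by move=> x; rewrite /imagpart !(linopZ linc) (linopB linc) cbc.
- move=> p pP pb x; have lp := oproj_lin pP.
  by rewrite /imagpart !(linopZ lp) (linopB lp) pb (comm_adj ipE pP abc pb).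
Qed.

Definition within T (a r : R) p :=
  forall x, nm (T (p x) - a%:C *: p x) <= r * nm (p x).

Lemma split_self T p (a r : R) : self_part T -> oproj ip p -> comm p b ->
  0 < r -> within T a r p ->
  exists e0 e1, [/\ oproj ip e0 /\ comm e0 b, oproj ip e1 /\ comm e1 b,
    (forall x, p x = e0 x + e1 x) /\
      ((forall x, p (e0 x) = e0 x) /\ (forall x, p (e1 x) = e1 x)),
    within T (a + r / 2) (r / 2) e0 & within T (a - r / 2) (r / 2) e1].
Proof.
move=> [bT aT bT' cT pT] pP pb r0 Tr.
have pT' := pT _ pP pb; have lp := oproj_lin pP.
pose T' x := T x - a%:C *: x.
have [||||||e0 [e1 [[e0P e1P] ee e0r e1r e01]]] := @split_proj _ _ _ ipE T' p r.
- by apply: bounded_opD => //; apply/bounded_opN/bounded_opZ/bounded_op_id.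
- by move=> x y; rewrite /T' !(ripDl, ripDr, ripNl, ripNr) ripZl ripZr aT.
- by [].
- by move=> x; rewrite /T' (linopB lp) (linopZ lp) pT'.
- by [].
- by move=> x; rewrite /T'; apply: Tr.
have commT S : linear S -> comm S T -> comm S T'.
  by move=> lS ST x; rewrite /T' (linopB lS) (linopZ lS) ST.
have pc := comm_adj ipE pP abc pb.
have [e0b e1b] : comm e0 b /\ comm e1 b.
  by apply: (e01 b c) => //; exact: commT.
exists e0, e1; split => // x.
  by have := e0r x; rewrite /T' rmorphD /= scalerDl opprD addrA.
by have := e1r x; rewrite /T' rmorphB /= scalerBl opprB addrA addrAC.
Qed.

Lemma within_sub T a r p e : within T a r p -> (forall x, p (e x) = e x) ->
  within T a r e.
Proof. by move=> pr pe x; rewrite -{1 2 3}pe; apply: pr. Qed.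

(** Cells are squares, described by the two self-adjoint parts, because bisection
    acts on one self-adjoint operator at a time. *)
Definition cell z (r : R) p := [/\ oproj ip p, comm p b,
  within realpart (complex.Re z) r p & within imagpart (complex.Im z) r p].

(* The zero projection is a cell, so an index beyond the end of a list is harmless. *)
Let dflt : R[i] * (H -> H) := (0, fun=> 0).

Definition cells (r : R) p := exists s : seq (R[i] * (H -> H)),
  (forall i, let t := nth dflt s i in cell t.1 r t.2) /\
  forall x, p x = \sum_(t <- s) t.2 x.

Lemma cell0 r : cell 0 r (fun=> 0).
Proof.
have h T : self_part T -> within T 0 r (fun=> 0).
  move=> [/bounded_opE[lT _] _ _ _ _] x.
  by rewrite (linop0 lT) scaler0 subr0 nm0 mulr0.
split; [exact: oproj0|by move=> x; rewrite (linop0 linb)| |].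
- by apply: h; exact: realpart_self.
- by apply: h; exact: imagpart_self.
Qed.

Lemma cells1 z r p : cell z r p -> cells r p.
Proof.
move=> zp; exists [:: (z, p)]; split; last by move=> x; rewrite big_seq1.
by case=> [|i] //=; rewrite nth_nil; exact: cell0.
Qed.

Lemma cellsD r p q (pq : H -> H) : cells r p -> cells r q ->
  (forall x, pq x = p x + q x) -> cells r pq.
Proof.
move=> [s [sr sp]] [t [tr tq]] pqE; exists (s ++ t); split.
  by move=> i; rewrite nth_cat; case: ifP.
by move=> x; rewrite big_cat /= pqE sp tq.
Qed.

Lemma cell_halve z r p : 0 < r -> cell z r p -> cells (r / 2) p.
Proof.
move=> r0 [pP pb pre pim].
have half e w : (forall x, p (e x) = e x) -> oproj ip e -> comm e b ->
    within realpart (complex.Re w) (r / 2) e -> cells (r / 2) e.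
  move=> pe eP eb ere; have eim := within_sub pim pe.
  have [f0 [f1 [[f0P f0b] [f1P f1b] [ef [ef0 ef1]] w0 w1]]] :=
    split_self imagpart_self eP eb r0 eim.
  apply: (@cellsD _ f0 f1) => //.
    apply: (@cells1 (complex.Re w +i* (complex.Im z + r / 2))).
    by split=> //; apply: within_sub ef0.
  apply: (@cells1 (complex.Re w +i* (complex.Im z - r / 2))).
  by split=> //; apply: within_sub ef1.
have [e0 [e1 [[e0P e0b] [e1P e1b] [pe [pe0 pe1]] w0 w1]]] :=
  split_self realpart_self pP pb r0 pre.
apply: (@cellsD _ e0 e1) => //.
  exact: (@half _ ((complex.Re z + r / 2) +i* 0)).
exact: (@half _ ((complex.Re z - r / 2) +i* 0)).
Qed.

Lemma cells_halve r p : 0 < r -> cells r p -> cells (r / 2) p.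
Proof.
move=> r0 [s [sr sp]]; elim: s p sr sp => [|t s IH] p sr sp.
  exists [::]; split=> // i /=; rewrite nth_nil; exact: cell0.
apply: (@cellsD _ t.2 (fun x => \sum_(u <- s) u.2 x)).
- exact: cell_halve r0 (sr 0%N).
- by apply: IH => // i; exact: (sr i.+1).
- by move=> x; rewrite sp big_cons.
Qed.

Lemma cell_id : exists2 r, 0 < r & cell 0 r (fun x => x).
Proof.
have [[/bounded_opE[_ [k k0 kT]] _ _ _ _]
      [/bounded_opE[_ [l l0 lT]] _ _ _ _]] := (realpart_self, imagpart_self).
exists (k + l + 1); first lra.
split=> // x; rewrite /= scale0r subr0.
  by apply: le_trans (kT x) _; rewrite ler_wpM2r ?nm_ge0 //; lra.
by apply: le_trans (lT x) _; rewrite ler_wpM2r ?nm_ge0 //; lra.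
Qed.

Lemma cell_loc z r p : cell z r p -> localized z (2 * r) p.
Proof.
move=> [pP pb pre pim]; split=> // x.
have -> : b (p x) - z *: p x =
    (realpart (p x) - (complex.Re z)%:C *: p x) +
    'i *: (imagpart (p x) - (complex.Im z)%:C *: p x).
  rewrite [in LHS]parts_sum {1}[z]complexE scalerDl scalerBr -scalerA.
  by rewrite opprD addrACA.
apply: le_trans (nmD _ _) _; rewrite nmZ cabsi mul1r.
by have := pre x; have := pim x; lra.
Qed.

(** After [n] bisections the cells are squares of half side [r / 2 ^ n], contained in discs
    of twice this radius. *)
Theorem partition_exists (e : R) : 0 < e ->
  exists n (z : nat -> R[i]) (p : nat -> H -> H),
    (forall i, localized (z i) e (p i)) /\
    forall x, x = \sum_(0 <= i < n) p i x.
Proof.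
move=> e0; have [r r0 /cells1 cr] := cell_id.
have {}cr n : cells (r / 2 ^+ n) (fun x => x).
  elim: n => [|n IH]; first by rewrite expr0 divr1.
  by rewrite exprSr invfM mulrA; apply: cells_halve => //; rewrite divr_gt0 ?exprn_gt0.
have half : `|(2^-1 : R)| < 1 by rewrite ger0_norm //; lra.
have /cvgrPdist_lt := @cvg_expr R _ half.
move=> /(_ (e / (2 * r))); rewrite divr_gt0 ?mulr_gt0 // => /(_ isT).
move=> [N _ /(_ N (leqnn N))] /=.
rewrite sub0r normrN ger0_norm ?invr_ge0 ?exprn_ge0 // => h.
have [s [sr sp]] := cr N.
exists (size s), (fun i => (nth dflt s i).1), (fun i => (nth dflt s i).2); split.
  move=> i /=; have [pP pb pe] := cell_loc (sr i); split=> // x.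
  apply: le_trans (pe x) _; rewrite ler_wpM2r ?nm_ge0 //.
  rewrite -exprVn; have := ltW h; rewrite ler_pdivlMr ?mulr_gt0 //; lra.
by move=> x; rewrite {1}(sp x) (big_nth dflt).
Qed.

End Partition.

(** * Compactness in the complex plane *)

Section Plane.
Variable R : realType.
Local Notation C := (R[i]^o).
Implicit Types (z w v : C) (K L D : set C) (e d : R).

Definition cdisc z e : set C := [set w | cabs (w - z) <= e].

Lemma nbhs_cabs z (U : set C) :
  nbhs z U <-> exists2 e : R, 0 < e & forall w, cabs (w - z) < e -> U w.
Proof.
split=> [/nbhs_ballP[e /= /lt0_cplx[r r0 ->] rU]|[e e0 eU]].
  exists r => // w wr; apply: rU; rewrite -ball_normE /= distrC.
  by rewrite [ `|_| ](cabsE (w - z)) ltcR.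
apply/nbhs_ballP; exists e%:C; first by rewrite /= ltcR.
move=> w; rewrite -ball_normE /= distrC [ `|_| ](cabsE (w - z)) ltcR; exact: eU.
Qed.

Lemma closed_gap L z : closed L -> ~ L z ->
  exists2 e : R, 0 < e & forall l, L l -> e <= cabs (l - z).
Proof.
move=> /closed_openC oL nLz.
have /nbhs_cabs[e e0 eL] : nbhs z (~` L) by apply: open_nbhs_nbhs.
exists e => // l Ll; rewrite leNgt; apply/negP => /eL; exact.
Qed.

Lemma cdisc_closed z e : closed (cdisc z e).
Proof.
rewrite -[X in closed X]setCK; apply: open_closedC; rewrite openE => w /= /negP.
rewrite -ltNge => ew; apply/nbhs_cabs.
exists (cabs (w - z) - e); first by rewrite subr_gt0.
move=> v vw; apply/negP; rewrite -ltNge.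
by have := cabs_le_tri v w z; rewrite (cabsC w v); lra.
Qed.

Lemma cabs_complex_le (a a' : R) : cabs (a +i* a') <= `|a| + `|a'|.
Proof.
rewrite [_ +i* _]complexE /=; apply: le_trans (cabsD _ _) _.
by rewrite cabsM cabsi mul1r !cabs_real.
Qed.

Lemma continuous_complex : continuous (fun x : (R * R)%type => x.1 +i* x.2 : C).
Proof.
move=> [a a'] U /nbhs_cabs[e e0 eU].
apply/nbhs_ballP; exists (e / 2); first by rewrite /= divr_gt0.
move=> [x x'] [/= xa xa']; apply: eU.
move: xa xa'; rewrite /ball /= => xa xa'.
rewrite (_ : x +i* x' - _ = (x - a) +i* (x' - a')) //.
apply: le_lt_trans (cabs_complex_le _ _) _; rewrite distrC (distrC x'); lra.
Qed.

Lemma cdisc_compact z e : compact (cdisc z e).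
Proof.
pose f := fun x : (R * R)%type => x.1 +i* x.2 : C.
pose r := e + cabs z.
have cK : compact (f @` (`[- r, r]%classic `*` `[- r, r]%classic)).
  apply: continuous_compact; last by apply: compact_setX; exact: segment_compact.
  by apply: continuous_subspaceT; exact: continuous_complex.
apply: subclosed_compact cK _; first exact: cdisc_closed.
move=> w wz; exists (complex.Re w, complex.Im w); last by case: (w).
have wr : cabs w <= r.
  by have := cabsD (w - z) z; rewrite subrK; move: wz; rewrite /cdisc /= /r; lra.
have := cabs2 w; have := cabs_ge0 w => c0 c2.
rewrite /= !in_itv /=; split; nra.
Qed.

Lemma closed_bounded_compact K z e : closed K -> K `<=` cdisc z e -> compact K.
Proof. by move=> cK Kz; apply: subclosed_compact cK (@cdisc_compact z e) Kz. Qed.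

Lemma compactC_closed K : compact K -> closed K.
Proof. by apply: compact_closed; exact: norm_hausdorff. Qed.

(** Compactness in the form of a Lebesgue number. *)
Lemma compact_gap K (P : R -> C -> Prop) : compact K ->
  (forall z, K z -> exists2 e, 0 < e &
     forall d w, 0 < d -> d < e -> cabs (w - z) < e -> P d w) ->
  exists2 d, 0 < d & forall z, K z -> P d z.
Proof.
move=> /compact_near_coveringP cK KP.
have [z Kz|e /= e0 eP] := cK R 0^'+ P _.
  have [e e0 eP] := KP z Kz; exists ([set w | cabs (w - z) < e], [set d | 0 < d < e]).
    split; first by apply/nbhs_cabs; exists e.
    near=> d; apply/andP; split; near: d; [exact: nbhs_right_gt|exact: nbhs_right_lt].
  by move=> [w d] [/= wz /andP[d0 de]]; exact: eP.
exists (e / 2); first by rewrite divr_gt0.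
move=> z Kz; apply: eP => //; last by rewrite divr_gt0.
by rewrite /= sub0r normrN gtr0_norm ?divr_gt0 //; move: e0 => /=; lra.
Unshelve. all: by end_near. Qed.

(** Each point of [K] has a positive distance from [L] or from [D]; by compactness one
    bound serves all points of [K]. *)
Lemma fine_scale K L D : compact K -> closed L -> closed D ->
  (forall z, K z -> L z -> D z -> False) ->
  exists2 d, 0 < d & forall w k l x, K k -> L l -> D x -> cabs (k - w) <= d ->
    cabs (l - w) <= d -> cabs (x - w) <= d -> False.
Proof.
move=> cK cL cD KLD.
have [z Kz|d d0 dP] := @compact_gap K (fun d k => forall w l x, L l -> D x ->
  cabs (k - w) <= d -> cabs (l - w) <= d -> cabs (x - w) <= d -> False) cK.
  have [[e e0 eP]|[e e0 eP]] :
      (exists2 e : R, 0 < e & forall l, L l -> e <= cabs (l - z)) \/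
      (exists2 e : R, 0 < e & forall l, D l -> e <= cabs (l - z)).
  - have [Lz|nLz] := pselect (L z); last by left; exact: closed_gap.
    by right; apply: closed_gap => // Dz; exact: (KLD z).
  - exists (e / 3) => [|d k d0 de kz w l x /eP Ll _ kw lw _]; first by rewrite divr_gt0.
    have := cabs_le_tri w l z; have := cabs_le_tri k w z; rewrite (cabsC w k); lra.
  - exists (e / 3) => [|d k d0 de kz w l x _ /eP Dx kw _ xw]; first by rewrite divr_gt0.
    have := cabs_le_tri w x z; have := cabs_le_tri k w z; rewrite (cabsC w k); lra.
by exists d => // w k l x /dP; apply.
Qed.

Lemma segment_point z w e d : 0 <= e -> 0 <= d -> cabs (z - w) <= e + d ->
  exists2 v, cabs (v - z) <= e & cabs (v - w) <= d.
Proof.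
move=> e0 d0 zw; have [ed|ed] := eqVneq (e + d) 0.
  have e00 : e = 0 by lra.
  exists z; first by rewrite subrr cabs0.
  by lra.
have edp : 0 < e + d by rewrite lt_def ed addr_ge0.
(* Divide the segment from [z] to [w] in the ratio [e : d]. *)
pose t := e / (e + d); have t0 : 0 <= t by rewrite divr_ge0 // ltW.
exists (z + t%:C * (w - z)).
  rewrite addrC addKr cabsM cabs_real ger0_norm // cabsC.
  by apply: le_trans (ler_wpM2l t0 zw) _; rewrite /t divfK.
have -> : z + t%:C * (w - z) - w = (1 - t)%:C * (z - w).
  by rewrite rmorphB /= rmorph1; ring.
have t1 : 1 - t = d / (e + d) by rewrite /t; field.
rewrite cabsM cabs_real t1 ger0_norm ?divr_ge0 ?(ltW edp) //.
apply: le_trans (ler_wpM2l _ zw) _; first by rewrite divr_ge0 // ltW.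
by rewrite divfK.
Qed.

End Plane.

(** * Spectral subspaces *)

Section SpectralSubspaces.
Variables (R : realType) (H : completeNormedModType R[i]).
Variables (ip : {dot H for Num.conj}) (ipE : hilbert_form ip).
Variables (b c : H -> H).
Hypotheses (bb : bounded_op b) (bc : bounded_op c) (abc : adj ip b c).
Hypothesis cbc : comm c b.
Local Notation C := (R[i]^o).
Implicit Types (x y : H) (z w : R[i]) (p q T : H -> H) (A K L F : set C).
Local Notation rip := (rip ip).
Local Notation localized := (localized ip b).

Let linb : linear b := bounded_linear bb.

(** The vectors carried by [K], described through what must kill them, so that neither a
    functional calculus nor a choice of partition is involved. *)
Definition specsub K : set H := [set x | forall z e p, localized z e p -> 0 <= e ->
  (forall w, K w -> e < cabs (w - z)) -> p x = 0].

Lemma specsub_mono K L : K `<=` L -> specsub K `<=` specsub L.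
Proof. by move=> KL x Kx z e p zp e0 Le; apply: (Kx z e) => // w /KL/Le. Qed.

Lemma specsub_closed K : closed_subspace (specsub K).
Proof.
split=> [z e p [pP _ _] _ _|a x y Kx Ky z e p zp e0 Ke|x xP z e p zp e0 Ke].
- by rewrite (linop0 (oproj_lin pP)).
- have [pP _ _] := zp; have lp := oproj_lin pP.
  by rewrite lp (Kx z e) // (Ky z e) // scaler0 addr0.
- have [pP _ _] := zp; apply: nm_small_eq0 => r /xP[y Ky xy].
  rewrite -[p x]subr0 -(Ky z e p zp e0 Ke) -(linopB (oproj_lin pP)).
  exact: le_trans (oproj_nm ipE pP _) (ltW xy).
Qed.

Lemma specsubT x : specsub setT x.
Proof. by move=> z e p _ e0 /(_ z I); rewrite subrr cabs0 ltNge e0. Qed.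

Lemma partition_nm (n : nat) (p : nat -> H -> H) : (forall i, oproj ip (p i)) ->
  (forall x, x = \sum_(0 <= i < n) p i x) ->
  forall x, nm x ^+ 2 = \sum_(0 <= i < n) nm (p i x) ^+ 2.
Proof.
move=> pP pE x; rewrite (nm2 ipE).
transitivity (rip (\sum_(0 <= i < n) p i x) x); first by rewrite -pE.
rewrite rip_suml.
by apply: eq_bigr => i _; rewrite oproj_rip.
Qed.

Lemma vanish_on_cells n (p : nat -> H -> H) T x : linear T ->
  (forall x, x = \sum_(0 <= i < n) p i x) ->
  (forall i, T (p i x) = 0) -> T x = 0.
Proof.
by move=> lT pE Tp; rewrite (pE x) (linop_sum lT) big1.
Qed.

(** Because a commutant element cannot move mass between separated
    cells, it preserves the spectral subspaces; since only commutation with [b] is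
    used, this contains Fuglede's theorem. *)
Lemma specsub_inv T K x : closed K -> bounded_op T -> comm T b ->
  specsub K x -> specsub K (T x).
Proof.
move=> cK bT Tb Kx z e p zp e0 Ke; have [pP pb pe] := zp.
have lT : linear T by case: bT.
have [d d0 dP] : exists2 d, 0 < d & forall w k l (v : C), cdisc z e k -> K l -> setT v ->
    cabs (k - w) <= d -> cabs (l - w) <= d -> cabs (v - w) <= d -> False.
  apply: fine_scale => //; first exact: cdisc_compact.
  by move=> w zw /Ke + _; rewrite ltNge => /negP; apply; exact: zw.
have [n [w [q [wq qE]]]] := partition_exists ipE bb bc abc cbc d0.
have lpT : linear (fun u => p (T u)).
  by move=> a u v; rewrite lT (oproj_lin pP).
apply: (@vanish_on_cells n q (fun u => p (T u))) => // i.
have [zw|zw] := ltP (e + d) (cabs (w i - z)).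
  by apply: (separation ipE (wq i) zp bT Tb); rewrite 1?addrC ?ltW.
have [v vz vw] : exists2 v, cabs (v - z) <= e & cabs (v - w i) <= d.
  by apply: segment_point; rewrite ?(ltW d0) // cabsC.
rewrite (_ : q i x = 0) ?(linop0 lT) ?(linop0 (oproj_lin pP)) //.
apply: (Kx (w i) d) => //; first exact: ltW.
move=> u Ku; rewrite ltNge; apply/negP => uw.
by apply: (dP (w i) v u (w i)) => //; rewrite subrr cabs0 ltW.
Qed.

(** Discs without common point have centres farther apart than the sum of their radii, so
    [separation] applies. *)
Lemma specsub_loc z e p x : localized z e p -> 0 <= e -> specsub (cdisc z e) (p x).
Proof.
move=> zp e0 w d q wq d0 we.
apply: (@separation _ _ _ ipE _ z w e d p q (fun x => x) zp wq) => //.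
  exact: bounded_op_id.
rewrite ltNge; apply/negP => zw.
have [v vz vw] := segment_point e0 d0 zw.
by have := we v vz; rewrite ltNge vw.
Qed.

(** A cell of a fine partition misses [K] or [L], and so kills one of the two vectors. *)
Lemma specsub_orth K L x y : compact K -> closed L ->
  (forall z, K z -> L z -> False) ->
  specsub K x -> specsub L y -> rip x y = 0.
Proof.
move=> cK cL KL Kx Ly.
have [d d0 dP] : exists2 d, 0 < d & forall w k l (v : C), K k -> L l -> setT v ->
    cabs (k - w) <= d -> cabs (l - w) <= d -> cabs (v - w) <= d -> False.
  by apply: fine_scale => // z /KL.
have [n [w [q [wq qE]]]] := partition_exists ipE bb bc abc cbc d0.
rewrite (qE x) rip_suml big1 // => i _; have [qP _ _] := wq i.
have [xi|/existsNP[k /not_implyP[Kk /negP]]] :=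
    pselect (forall k, K k -> d < cabs (k - w i)).
  by rewrite (Kx (w i) d) ?rip0l // ltW.
rewrite -leNgt => kw.
rewrite (oproj_adj qP) (Ly (w i) d) ?rip0r ?(ltW d0) // => l Ll.
rewrite ltNge; apply/negP => lw.
by apply: (dP (w i) k l (w i)) => //; rewrite subrr cabs0 ltW.
Qed.

(** Cells far from the given disc are killed by [separation]; the others, if they are fine
    enough, miss [K] or [L]. *)
Lemma specsubI K L x : compact K -> closed L ->
  specsub K x -> specsub L x -> specsub (K `&` L) x.
Proof.
move=> cK cL Kx Lx z e p zp e0 KLe; have [pP pb pe] := zp.
have [d d0 dP] : exists2 d, 0 < d & forall w k l (v : C), K k -> L l -> cdisc z e v ->
    cabs (k - w) <= d -> cabs (l - w) <= d -> cabs (v - w) <= d -> False.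
  apply: fine_scale => //; first exact: cdisc_closed.
  by move=> w Kw Lw; apply/negP; rewrite -ltNge; apply: KLe.
have [n [w [q [wq qE]]]] := partition_exists ipE bb bc abc cbc d0.
apply: (vanish_on_cells (oproj_lin pP) qE) => i.
have [zw|zw] := ltP (e + d) (cabs (w i - z)).
  apply: (@separation _ _ _ ipE _ _ _ _ _ _ _ (fun x => x) (wq i) zp) => //.
  - exact: bounded_op_id.
  - exact: ltW.
  - by rewrite addrC.
have [v vz vw] : exists2 v, cabs (v - z) <= e & cabs (v - w i) <= d.
  by apply: segment_point; rewrite ?(ltW d0) // cabsC.
rewrite (_ : q i x = 0) ?(linop0 (oproj_lin pP)) //.
have [xi|/existsNP[k /not_implyP[Kk /negP]]] :=
    pselect (forall k, K k -> d < cabs (k - w i)).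
  by apply: (Kx (w i) d) => //; exact: ltW.
rewrite -leNgt => kw.
apply: (Lx (w i) d) => //; first exact: ltW.
move=> l Ll; rewrite ltNge; apply/negP => lw.
exact: (dP (w i) k l v).
Qed.

(** Only the cells that meet [K] contribute, and on them [b - z] is at most [e + 2 * d]; the
    Parseval identity of the partition carries this bound over to [y]. *)
Lemma specsub_bound K z e y : K `<=` cdisc z e -> 0 <= e -> specsub K y ->
  nm (b y - z *: y) <= e * nm y.
Proof.
move=> Kz e0 Ky; apply/ler_addgt0Pl => r r0.
pose d := r / (2 * (nm y + 1)).
have d0 : 0 < d by rewrite divr_gt0 // mulr_gt0 // ltr_wpDl ?nm_ge0.
have [n [w [q [wq qE]]]] := partition_exists ipE bb bc abc cbc d0.
have qP i : oproj ip (q i) by case: (wq i).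
suff h : nm (b y - z *: y) <= (e + 2 * d) * nm y.
  apply: le_trans h _; have : d * (2 * (nm y + 1)) = r.
    by rewrite divfK // gt_eqF // mulr_gt0 // ltr_wpDl ?nm_ge0.
  have := nm_ge0 y; lra.
have ed : 0 <= e + 2 * d by rewrite addr_ge0 // mulr_ge0 // ltW.
rewrite -ler_sqr ?nnegrE ?nm_ge0 ?mulr_ge0 ?nm_ge0 //.
rewrite exprMn !(partition_nm qP qE) mulr_sumr; apply: ler_sum => i _.
rewrite -exprMn ler_sqr ?nnegrE ?nm_ge0 ?mulr_ge0 ?nm_ge0 //.
have [_ qb qd] := wq i; have lq := oproj_lin (qP i).
rewrite (linopB lq) (linopZ lq) qb.
have [xi|/existsNP[k /not_implyP[Kk /negP]]] :=
    pselect (forall k, K k -> d < cabs (k - w i)).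
  by rewrite (Ky (w i) d (q i) (wq i) (ltW d0) xi) (linop0 linb) scaler0
    subr0 nm0 mulr0.
rewrite -leNgt => kw.
have wz : cabs (w i - z) <= e + d.
  have := cabs_le_tri k (w i) z; rewrite (cabsC (w i) k).
  by have := Kz k Kk; rewrite /cdisc /=; lra.
have -> : b (q i y) - z *: q i y = (b (q i y) - w i *: q i y) + (w i - z) *: q i y.
  by rewrite scalerBl addrA subrK.
apply: le_trans (nmD _ _) _; rewrite nmZ.
by have := qd y; have := ler_wpM2r (nm_ge0 (q i y)) wz; lra.
Qed.

(** The spectral subspace of an arbitrary set, approximated from inside by
    compact sets: inner regularity is built in. *)
Definition innersub A : set H := [set x | forall e : R, 0 < e ->
  exists K, [/\ compact K, K `<=` A & exists2 y, specsub K y & nm (x - y) < e]].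

Lemma innersubI A K y : compact K -> K `<=` A -> specsub K y -> innersub A y.
Proof.
by move=> cK KA Ky e e0; exists K; split=> //; exists y => //; rewrite subrr nm0.
Qed.

Lemma innersub_mono A F : A `<=` F -> innersub A `<=` innersub F.
Proof.
move=> AF x Ax e /Ax[K [cK KA xK]]; exists K; split=> //.
exact: subset_trans AF.
Qed.

Lemma innersub_closed A : closed_subspace (innersub A).
Proof.
split=> [|a x y Ax Ay e e0|x xP e e0].
- apply: (@innersubI _ set0) => //; first exact: compact0.
  exact: sub0 (specsub_closed _).
- pose r := e / (2 * (cabs a + 1)).
  have a0 := cabs_ge0 a.
  have r0 : 0 < r by rewrite divr_gt0 // mulr_gt0 //; lra.
  have [K [cK KA [x' Kx xx]]] := Ax _ r0.
  have [L [cL LA [y' Ly yy]]] := Ay (e / 2) ltac:(lra).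
  exists (K `|` L); split; [exact: compactU|by move=> w [/KA|/LA]|].
  exists (a *: x' + y').
    case: (specsub_closed (K `|` L)) => _ DM _; apply: DM.
      by apply: specsub_mono Kx; exact: subsetUl.
    by apply: specsub_mono Ly; exact: subsetUr.
  rewrite opprD addrACA -scalerBr; apply: le_lt_trans (nmD _ _) _; rewrite nmZ.
  have : cabs a * nm (x - x') <= e / 2.
    apply: le_trans (ler_wpM2l a0 (ltW xx)) _.
    rewrite /r mulrCA ler_pM2l //.
    rewrite ler_pdivrMr ?mulr_gt0 //; lra.
  lra.
- have [y Ay xy] := xP (e / 2) ltac:(lra).
  have [K [cK KA [u Ku yu]]] := Ay (e / 2) ltac:(lra).
  exists K; split=> //; exists u => //.
  by have := nm_tri y x u; lra.
Qed.

Lemma innersub_compact K : compact K -> innersub K `<=` specsub K.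
Proof.
move=> cK x Kx; apply: (sub_closed (specsub_closed K)) => e /Kx[L [_ LK [y Ly xy]]].
by exists y => //; apply: specsub_mono Ly.
Qed.

Lemma orth_innersub A x :
  (forall K y, compact K -> K `<=` A -> specsub K y -> rip x y = 0) ->
  forall v, innersub A v -> rip x v = 0.
Proof.
move=> xA v Av; apply/eqP; rewrite -normr_eq0 eq_le normr_ge0 andbT.
apply/ler_addgt0Pl => e e0; rewrite addr0.
have r0 : 0 < e / (nm x + 1) by rewrite divr_gt0 // ltr_wpDl ?nm_ge0.
have [K [cK KA [y Ky vy]]] := Av _ r0.
rewrite -[v](subrK y) ripDr (xA K y) // addr0.
apply: le_trans (cauchy_schwarz_abs ipE _ _) _.
apply: le_trans (ler_wpM2l (nm_ge0 x) (ltW vy)) _.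
rewrite mulrCA ler_piMr ?(ltW e0) // ler_pdivrMr ?mul1r; last first.
  by rewrite ltr_wpDl ?nm_ge0.
lra.
Qed.

Lemma innersub_orth A F x y : (forall z, A z -> F z -> False) ->
  innersub A x -> innersub F y -> rip x y = 0.
Proof.
move=> AF Ax Fy; apply: (orth_innersub _ Fy) => L u cL LF Lu.
rewrite ripC; apply: (orth_innersub _ Ax) => K v cK KA Kv.
apply: (specsub_orth cL (compactC_closed cK)) Lu Kv => z /LF Fz /KA Az.
exact: (AF z).
Qed.

(** A projection localised off [F] has its range in the subspace of a disc off [F]. *)
Lemma innersub_perp F x :
  (forall v, innersub (~` F) v -> rip x v = 0) -> specsub F x.
Proof.
move=> xF z e p zp e0 Fe; have [pP _ _] := zp.
have : rip x (p x) = 0.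
  apply: xF; apply: (@innersubI _ (cdisc z e)).
  - exact: cdisc_compact.
  - by move=> w wz /Fe; rewrite ltNge => /negP; apply; exact: wz.
  - exact: specsub_loc.
rewrite ripC (oproj_rip ipE pP) => /eqP; rewrite sqrf_eq0 => /eqP.
exact: nm0_eq0.
Qed.

Lemma innersub_inv A T x : bounded_op T -> comm T b ->
  innersub A x -> innersub A (T x).
Proof.
move=> bT Tb Ax e e0; have [lT [k k0 kT]] := (bounded_opE T).1 bT.
have r0 : 0 < e / (k + 1) by rewrite divr_gt0 //; lra.
have [K [cK KA [y Ky xy]]] := Ax _ r0.
exists K; split=> //; exists (T y).
  by apply: specsub_inv => //; exact: compactC_closed.
rewrite -(linopB lT); apply: le_lt_trans (kT _) _.
apply: le_lt_trans (ler_wpM2l k0 (ltW xy)) _.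
rewrite mulrCA -[ltRHS]mulr1 ltr_pM2l // ltr_pdivrMr ?mul1r; lra.
Qed.

Lemma innersub_bound A z e y : A `<=` cdisc z e -> 0 <= e -> innersub A y ->
  nm (b y - z *: y) <= e * nm y.
Proof.
move=> Az e0 Ay; apply/ler_addgt0Pl => r r0.
have [_ [k k0 kb]] := (bounded_opE b).1 bb.
pose m := k + cabs z + e + 1.
have m0 : 0 < m by rewrite /m; have := cabs_ge0 z; lra.
have [K [cK KA [u Ku yu]]] := Ay _ (divr_gt0 r0 m0).
have h := specsub_bound (subset_trans KA Az) e0 Ku.
have -> : b y - z *: y = (b (y - u) - z *: (y - u)) + (b u - z *: u).
  rewrite (linopB linb) scalerBr opprB [z *: u - _]addrC [b y - b u + _]addrACA.
  by rewrite [- b u + _]addrC -[b u - z *: u]opprB addrK.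
apply: le_trans (nmD _ _) _.
have h1 := kb (y - u).
have h2 := nmD (b (y - u)) (- (z *: (y - u))); rewrite nmN nmZ in h2.
have h3 := nmD u (y - u).
have h4 := nm_tri y u 0.
have h5 : nm u <= nm y + nm (y - u).
  by have := nmD y (u - y); rewrite addrCA subrr addr0 (nmC u).
have h6 := ler_wpM2l e0 h5.
have h7 : m * nm (y - u) <= r.
  by have := ler_wpM2l (ltW m0) (ltW yu); rewrite mulrCA divff ?gt_eqF // mulr1.
have := nm_ge0 (y - u); move: h7; rewrite /m; lra.
Qed.

End SpectralSubspaces.

(** * The spectrum of a normal operator *)

Section Spectrum.
Variables (R : realType) (H : completeNormedModType R[i]).
Variables (ip : {dot H for Num.conj}) (ipE : hilbert_form ip).
Variables (b c : H -> H).
Hypotheses (bb : bounded_op b) (bc : bounded_op c) (abc : adj ip b c).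
Hypothesis cbc : comm c b.
Local Notation C := (R[i]^o).
Implicit Types (x y : H) (z w : R[i]) (p q T : H -> H) (A K L F : set C).
Local Notation rip := (rip ip).
Local Notation localized := (localized ip b).
Local Notation specsub := (specsub ip b).

Let linb : linear b := bounded_linear bb.

Definition bounded_below w (e : R) := forall y, e * nm y <= nm (b y - w *: y).

Lemma shift_bounded w : bounded_op (fun x => b x - w *: x).
Proof.
by apply: bounded_opD => //; apply/bounded_opN/bounded_opZ/bounded_op_id.
Qed.

Lemma resolvent_bounded_below w : ~ spectrum b w -> exists2 e, 0 < e & bounded_below w e.
Proof.
move=> /contrapT[S /bounded_opE[_ [k k0 kS]] [_ ST]].
exists (k + 1)^-1; first by rewrite invr_gt0; lra.
move=> y; have : S (b y - w *: y) = y by have := congr1 (@^~ y) ST.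
move=> {1}<-; rewrite ler_pdivrMl; last lra.
apply: le_trans (kS _) _; rewrite ler_wpM2r ?nm_ge0 //; lra.
Qed.

Lemma ripZ_adj w x y : rip (w *: x) y = rip x ((w^*)%C *: y).
Proof. by rewrite /rip linearZl_LR /= linearZr_LR /= conjE conjcK. Qed.

(** Normality makes the operator and its adjoint have the same kernel, so a lower bound
    gives dense range. *)
Lemma bounded_below_resolvent w e : 0 < e -> bounded_below w e -> ~ spectrum b w.
Proof.
move=> e0 we; apply; pose T x := b x - w *: x; pose T' x := c x - (w^*)%C *: x.
have bT : bounded_op T := shift_bounded w.
have [lT [k k0 kT]] := (bounded_opE T).1 bT.
have lc := bounded_linear bc.
have aT : adj ip T T'.
  by move=> x y; rewrite !(ripDl, ripDr, ripNl, ripNr) abc ripZ_adj.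
have TT x : T (T' x) = T' (T x).
  rewrite /T /T' (linopB linb) (linopB lc) (linopZ linb) (linopZ lc) cbc.
  rewrite !scalerBr !scalerA (mulrC w) !opprB !addrA [LHS]addrAC [RHS]addrAC.
  by congr (_ + _); rewrite addrAC.
have nT x : nm (T' x) = nm (T x).
  have h : rip (T' x) (T' x) = rip (T x) (T x) by rewrite -aT TT ripC -aT.
  by apply/eqP; rewrite eq_le !nm_le // !(nm2 ipE) h.
have injT x y : T x = T y -> x = y.
  move=> xy; apply/eqP; rewrite -subr_eq0; apply/eqP/nm0_eq0/eqP.
  rewrite eq_le nm_ge0 andbT -(pmulr_rle0 _ e0).
  by apply: le_trans (we _) _; rewrite -/(T (x - y)) (linopB lT) xy subrr nm0.
have cM : closed_subspace (range T).
  split; first by exists 0 => //; exact: linop0.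
    by move=> a _ _ [x _ <-] [y _ <-]; exists (a *: x + y) => //; exact: lT.
  move=> x xT.
  have ex n : exists y, nm (x - T y) < n.+1%:R^-1.
    by have [|_ [y _ <-] xy] := xT n.+1%:R^-1; [|exists y].
  have [u uP] := choice ex.
  have [y yP] : exists l, forall e : R, 0 < e -> exists N, forall n, (N <= n)%N ->
     nm (u n - l) < e.
    apply: nm_complete => r r0.
    have er : 0 < e * r / 2 by rewrite divr_gt0 // mulr_gt0.
    have [N _ NP] := near_infty_natSinv_lt (PosNum er).
    exists N => m n Nm Nn; rewrite -(ltr_pM2l e0); apply: le_lt_trans (we _) _.
    rewrite -/(T (u m - u n)) (linopB lT).
    have /= h1 := NP m Nm; have /= h2 := NP n Nn.
    have := nm_tri x (T (u m)) (T (u n)); rewrite (nmC (T (u m)) x).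
    have h3 := lt_trans (uP m) h1; have h4 := lt_trans (uP n) h2; lra.
  exists y => //; apply/esym/eqP; rewrite -subr_eq0; apply/eqP.
  apply: (@nm_scaled_small _ _ _ (k + 1)) => r r0.
  have [N NP] := yP r r0; have [M _ MP] := near_infty_natSinv_lt (PosNum r0).
  pose n := maxn N M.
  have h1 := NP n (leq_maxl _ _); have /= h2 := MP n (leq_maxr _ _).
  have h3 := lt_trans (uP n) h2; have h4 := kT (u n - y).
  have := nm_tri (T (u n)) x (T y); rewrite -(linopB lT).
  have := ler_wpM2l k0 (ltW h1); lra.
have surT x : exists y, T y = x.
  have [m [y _ <-] mP] := foot_exists ipE cM x.
  exists y; apply/esym/eqP; rewrite -subr_eq0; apply/eqP.
  set v := x - T y; have T'v : T' v = 0.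
    apply: (rip_eq0 (ip := ip) ipE) => u; rewrite ripC -aT ripC.
    by apply: mP; exists u.
  by apply: injT; rewrite (linop0 lT); apply: nm0_eq0; rewrite -nT T'v nm0.
have [S SP] := choice surT.
exists S; last first.
  by split; apply/funext => x /=; [exact: SP|apply: injT; exact: SP].
apply/bounded_opE; split.
  by move=> a x y; apply: injT; rewrite lT !SP.
exists e^-1; first by rewrite invr_ge0 ltW.
by move=> x; rewrite -ler_pdivrMl ?invr_gt0 // invrK; apply: le_trans (we _) _;
  rewrite -/(T (S x)) SP.
Qed.

Lemma bounded_below_near w e v :
  bounded_below w e -> cabs (v - w) <= e / 2 -> bounded_below v (e / 2).
Proof.
move=> we vw y; have := nmB_ge (b y - w *: y) ((v - w) *: y).
rewrite nmZ (_ : _ - _ - _ = b y - v *: y); last first.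
  by rewrite scalerBl opprB addrA subrK.
have := ler_wpM2r (nm_ge0 y) vw; have := we y; lra.
Qed.

(** For a normal operator the resolvent set is given by lower bounds, which are stable
    under small perturbations. *)
Lemma spectrum_closed : closed (spectrum b).
Proof.
rewrite -[X in closed X]setCK; apply: open_closedC; rewrite openE => w.
move=> /resolvent_bounded_below[e e0 we]; apply/nbhs_cabs.
exists (e / 2) => [|v vw]; first by rewrite divr_gt0.
apply: (@bounded_below_resolvent v (e / 2)); first by rewrite divr_gt0.
by apply: bounded_below_near we _; exact: ltW.
Qed.

Lemma spectrum_bounded : exists r, spectrum b `<=` cdisc 0 r.
Proof.
have [_ [k k0 kb]] := (bounded_opE b).1 bb.
exists (k + 1) => w wb; rewrite /cdisc /= subr0 leNgt; apply/negP => kw.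
apply: (@bounded_below_resolvent w 1) wb => // y.
have := nmB_ge (w *: y) (b y); rewrite nmZ nmC; have := kb y.
have := ler_wpM2r (nm_ge0 y) (ltW kw); lra.
Qed.

Lemma spectrum_compact : compact (spectrum b).
Proof.
have [r rb] := spectrum_bounded.
exact: closed_bounded_compact spectrum_closed rb.
Qed.

(** Off the spectrum [b - w] is bounded below, so small cells vanish there. *)
Lemma specsub_spectrum x : specsub (spectrum b) x.
Proof.
move=> z e p zp e0 spe; have [pP pb pe] := zp.
have [w zw|d d0 dP] := @compact_gap R (cdisc z e)
    (fun d w => forall q, localized w (2 * d) q -> forall y, q y = 0)
    (@cdisc_compact R z e).
  have [|r r0 wr] := @resolvent_bounded_below w.
    by move=> /spe; rewrite ltNge => /negP; apply.
  exists (r / 4) => [|d v d0 dr vw q [_ _ qd] y]; first by rewrite divr_gt0.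
  have h : bounded_below v (r / 2) by apply: bounded_below_near wr _; lra.
  apply: nm0_eq0; apply/eqP; rewrite eq_le nm_ge0 andbT.
  have := h (q y); have := qd y => h1 h2.
  by rewrite -(@pmulr_rle0 _ (r / 2 - 2 * d)); lra.
have [n [w [q [wq qE]]]] := partition_exists ipE bb bc abc cbc d0.
apply: (vanish_on_cells (oproj_lin pP) qE) => i.
have [zw|zw] := ltP (e + d) (cabs (w i - z)).
  apply: (@separation _ _ _ ipE _ _ _ _ _ _ _ (fun x => x) (wq i) zp) => //.
  - exact: bounded_op_id.
  - exact: ltW.
  - by rewrite addrC.
have [v vz vw] : exists2 v, cabs (v - z) <= e & cabs (v - w i) <= d.
  by apply: segment_point; rewrite ?(ltW d0) // cabsC.
rewrite (dP v vz (q i)) ?(linop0 (oproj_lin pP)) //.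
have [qP qb qd] := wq i; split=> // y.
have -> : b (q i y) - v *: q i y = (b (q i y) - w i *: q i y) + (w i - v) *: q i y.
  by rewrite scalerBl addrA subrK.
apply: le_trans (nmD _ _) _; rewrite nmZ (cabsC (w i)).
by have := qd y; have := ler_wpM2r (nm_ge0 (q i y)) vw; lra.
Qed.

Lemma spectrum_neq0 : (exists x : H, x != 0) -> spectrum b !=set0.
Proof.
move=> [x /eqP x0]; apply/set0P/eqP => sp0; apply: x0; apply: nm0_eq0.
apply/eqP; rewrite -sqrf_eq0 (nm2 ipE); apply/eqP.
apply: (specsub_orth ipE bb bc abc cbc spectrum_compact spectrum_closed);
  [|exact: specsub_spectrum..].
by rewrite sp0.
Qed.

(** If the spectral subspace of a disc about [w] vanished, [b - w] would be bounded
    below. *)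
Lemma spectrum_charged w (e : R) : spectrum b w -> 0 < e ->
  exists2 y, specsub (cdisc w e `&` spectrum b) y & y <> 0.
Proof.
move=> wb e0; apply: contrapT => no.
have zero y : specsub (cdisc w e) y -> y = 0.
  move=> wy; apply: contrapT => y0; apply: no; exists y => //.
  apply: (specsubI ipE bb bc abc cbc) => //.
  - exact: cdisc_compact.
  - exact: spectrum_closed.
  - exact: specsub_spectrum.
(* Cells of radius [d] centred within [3 * d] of [w] lie in the disc; on all others [b - w]
   is at least [3 * d - d]. *)
pose d := e / 4; have d0 : 0 < d by rewrite divr_gt0.
apply: (@bounded_below_resolvent w (2 * d)) wb; first by rewrite mulr_gt0.
have [n [z [q [zq qE]]]] := partition_exists ipE bb bc abc cbc d0.
have qP i : oproj ip (q i) by case: (zq i).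
move=> y; rewrite -ler_sqr ?nnegrE ?nm_ge0 ?mulr_ge0 ?nm_ge0 ?(ltW e0) //.
rewrite exprMn !(partition_nm ipE qP qE) mulr_sumr; apply: ler_sum => i _.
rewrite -exprMn ler_sqr ?nnegrE ?nm_ge0 ?mulr_ge0 ?nm_ge0 ?(ltW e0) //.
have [_ qb qd] := zq i; have lq := oproj_lin (qP i).
rewrite (linopB lq) (linopZ lq) qb.
have [zw|zw] := leP (cabs (z i - w)) (3 * d).
  rewrite (zero (q i y)); first by rewrite nm0 mulr0 nm_ge0.
  apply: (specsub_mono _ (specsub_loc ipE y (zq i) (ltW d0))) => v vz.
  have := cabs_le_tri (z i) v w; move: vz zw; rewrite /cdisc /= /d; lra.
have := nmB_ge ((z i - w) *: q i y) (- (b (q i y) - z i *: q i y)).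
rewrite nmN nmZ opprK (_ : _ *: _ + _ = b (q i y) - w *: q i y); last first.
  by rewrite scalerBl addrC addrA subrK.
move=> h.
have := qd y; have := ler_wpM2r (nm_ge0 (q i y)) (ltW zw); lra.
Qed.

End Spectrum.

(** * The sigma-algebra of splitting sets *)

Section Splitting.
Variables (R : realType) (H : completeNormedModType R[i]).
Variables (ip : {dot H for Num.conj}) (ipE : hilbert_form ip).
Variables (b c : H -> H).
Hypotheses (bb : bounded_op b) (bc : bounded_op c) (abc : adj ip b c).
Hypothesis cbc : comm c b.
Local Notation C := (R[i]^o).
Implicit Types (x y : H) (z w : R[i]) (A K L F : set C).
Local Notation rip := (rip ip).
Local Notation specsub := (specsub ip b).
Local Notation innersub := (innersub ip b).

Definition perp x A := forall v, innersub A v -> rip x v = 0.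

Definition specproj A : H -> H := projOn ip (innersub A).

Let cI A : closed_subspace (innersub A) := innersub_closed ipE b A.

Lemma specproj_oproj A : oproj ip (specproj A).
Proof. exact: projOn_oproj. Qed.

Lemma specproj_in A x : innersub A (specproj A x).
Proof. exact: projOn_in. Qed.

Lemma specproj_perp A x : perp (x - specproj A x) A.
Proof. by move=> v; apply: projOn_orth. Qed.

Lemma specproj_id A x : innersub A x -> specproj A x = x.
Proof. exact: projOn_id. Qed.

Lemma specproj_eq0 A x : perp x A -> specproj A x = 0.
Proof. exact: projOn_eq0. Qed.

Lemma specproj_disj A F x : (forall z, A z -> F z -> False) ->
  perp (specproj A x) F.
Proof.
move=> AF v Fv.
exact: (innersub_orth ipE bb bc abc cbc AF (specproj_in A x)).
Qed.

Lemma perp_mono A F x : A `<=` F -> perp x F -> perp x A.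
Proof. by move=> AF xF v /(innersub_mono AF); apply: xF. Qed.

Lemma perpB A x y : perp x A -> perp y A -> perp (x - y) A.
Proof. by move=> xA yA v Av; rewrite ripDl ripNl xA // yA // subrr. Qed.

(** The analogue of measurability in the sense of Caratheodory: nothing is lost between [A]
    and its complement. *)
Definition splitting A := forall x, perp x A -> perp x (~` A) -> x = 0.

Lemma splittingC A : splitting A -> splitting (~` A).
Proof. by move=> sA x xA; rewrite setCK => xA'; apply: sA. Qed.

Lemma splitting_sum A x : splitting A -> x = specproj A x + specproj (~` A) x.
Proof.
move=> sA; apply/eqP; rewrite -subr_eq0; apply/eqP; apply: sA.
  rewrite opprD addrA; apply: perpB; first exact: specproj_perp.
  by apply: specproj_disj => z nAz /nAz.
rewrite opprD addrA addrAC; apply: perpB; first exact: specproj_perp.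
by apply: specproj_disj => z Az; apply.
Qed.

Lemma splitting_perp A x : splitting A -> perp x A -> innersub (~` A) x.
Proof.
move=> sA xA; rewrite (splitting_sum x sA) (specproj_eq0 xA) add0r.
exact: specproj_in.
Qed.

Lemma specsub_innersub F x : closed F -> specsub F x -> innersub F x.
Proof.
move=> cF Fx; have cS := spectrum_compact ipE bb bc abc cbc.
apply: (@innersubI _ _ ip b F (spectrum b `&` F)).
- exact: compact_closedI.
- exact: subIsetr.
- apply: (specsubI ipE bb bc abc cbc) => //.
  exact: (specsub_spectrum ipE bb bc abc cbc).
Qed.

(** What is orthogonal to the complement of [F] is carried by [F], hence by its compact
    intersection with the spectrum. *)
Lemma splitting_closed F : closed F -> splitting F.
Proof.
move=> cF x xF xFc; apply: nm0_eq0; apply/eqP; rewrite -sqrf_eq0 (nm2 ipE).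
apply/eqP/xF/specsub_innersub => //.
exact: (innersub_perp ipE).
Qed.

Lemma specproj_comm A T S : bounded_op T -> bounded_op S -> adj ip T S ->
  comm T b -> comm S b -> comm (specproj A) T.
Proof.
move=> bT bS TS Tb Sb; have lT : linear T by case: bT.
apply: (projOn_comm ipE (cI A) lT TS) => x; exact: (innersub_inv ipE bb bc abc cbc).
Qed.

Lemma bounded_specproj A : bounded_op (specproj A).
Proof. exact: (oproj_bounded ipE (specproj_oproj A)). Qed.

Lemma specproj_b A : comm (specproj A) b.
Proof. exact: (@specproj_comm A b c). Qed.

Lemma specproj_near A x K y : specsub K y -> compact K -> K `<=` A ->
  nm (x - specproj A x) <= nm (x - y).
Proof.
move=> Ky cK KA; have Ay : innersub A y by apply: innersubI Ky.
have -> : x - specproj A x = (x - y) - specproj A (x - y).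
  rewrite (linopB (oproj_lin (specproj_oproj A))) (specproj_id Ay).
  by rewrite opprB addrA subrK.
exact: (oproj_nm ipE (oproj_compl (specproj_oproj A))).
Qed.

Section Sequence.
Variables (A : nat -> set C) (x : H).
Hypothesis sA : forall n, splitting (A n).
Hypothesis xA : forall n, perp x (A n).

Let inter (L : nat -> set C) N : set C := [set z | forall i, (i < N)%N -> L i z].

Let interS (L : nat -> set C) N : inter L N.+1 = L N `&` inter L N.
Proof.
apply/seteqP; split=> z /=.
  by move=> zL; split=> [|i iN]; apply: zL => //; exact: ltnW.
by move=> [LN zL] i; rewrite ltnS leq_eqVlt => /orP[/eqP ->//|]; exact: zL.
Qed.

Let inter_closed (L : nat -> set C) N : (forall n, closed (L n)) -> closed (inter L N).
Proof.
move=> cL; elim: N => [|N IH]; last by rewrite interS; apply: closedI.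
by rewrite (_ : inter L 0 = setT) //; apply/seteqP; split.
Qed.

(** A vector orthogonal to all [A n] is, up to [e], carried by the compact sets
    [inter L N], where [L n] is a large compact subset of the complement of [A n]: the
    errors of the projections on the [L n] add up to at most [e]. *)
Let avoid (e : R) : 0 < e -> exists L : nat -> set C,
  (forall n, compact (L n) /\ L n `<=` ~` A n) /\
  forall N, exists2 y, specsub (inter L N) y & nm (x - y) <= e.
Proof.
move=> e0; have ex n : exists L, (compact L /\ L `<=` ~` A n) /\
  exists2 y, specsub L y & nm (x - y) < e / 2 ^+ n.+1.
  have en : 0 < e / 2 ^+ n.+1 by rewrite divr_gt0 ?exprn_gt0.
  by have [L [cL LA h]] := splitting_perp (@sA n) (@xA n) en; exists L.
have [L LP] := choice ex; exists L; split; first by move=> n; case: (LP n).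
have clL n : closed (L n) by apply: compactC_closed; case: (LP n) => -[].
suff h N : exists2 y, specsub (inter L N) y & nm (x - y) <= e * (1 - (2 ^+ N)^-1).
  move=> N; have [y Ky xy] := h N; exists y => //; apply: le_trans xy _.
  by rewrite -[leRHS]mulr1 ler_pM2l // gerBl invr_ge0 exprn_ge0.
elim: N => [|N [y Ky xy]].
  exists x; last by rewrite subrr nm0 expr0 invr1 subrr mulr0.
  by rewrite (_ : inter L 0 = setT); [exact: specsubT|apply/seteqP; split].
have [[cL LA] [u Lu xu]] := LP N.
exists (specproj (L N) y).
  rewrite interS; apply: (specsubI ipE bb bc abc cbc) => //; first exact: inter_closed.
    by apply: (innersub_compact ipE cL); exact: specproj_in.
  apply: (specsub_inv ipE bb bc abc cbc) Ky; first exact: inter_closed.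
    exact: bounded_specproj.
  exact: specproj_b.
have h1 := @specproj_near (L N) x _ _ Lu cL (@subset_refl _ _).
have h2 := oproj_nm ipE (specproj_oproj (L N)) (x - y).
rewrite (linopB (oproj_lin (specproj_oproj _))) in h2.
have := nm_tri (specproj (L N) x) x (specproj (L N) y).
rewrite exprSr invfM; have := ltW xu; rewrite exprSr invfM.
lra.
Qed.

Let compact_avoid (L : nat -> set C) K : (forall n, closed (L n)) -> compact K ->
  (forall z, K z -> (forall n, L n z) -> False) ->
  exists N, forall z, K z -> inter L N z -> False.
Proof.
move=> cL /compact_near_coveringP cK KL.
have [z Kz|N _ NP] := cK nat \oo (fun N z => ~ inter L N z) _.
  have /existsNP[n nLz] : ~ forall n, L n z by move=> h; apply: (KL z).
  exists (~` L n, [set N | (n < N)%N]) => /=.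
    split; last by exists n.+1.
    by apply: open_nbhs_nbhs; split=> //; exact: closed_openC.
  by move=> [v N] /= [nLv nN] h; apply: nLv; apply: h.
by exists N => z Kz; exact: (NP N (leqnn N) z Kz).
Qed.

(** A compact set missing all common points of the [L n] misses those of finitely many of
    them. *)
Let avoid_orth (e : R) : 0 < e -> exists L : nat -> set C,
  (forall n, compact (L n) /\ L n `<=` ~` A n) /\
  forall K u, compact K -> (forall z, K z -> (forall n, L n z) -> False) ->
    specsub K u -> `|rip x u| <= e * nm u.
Proof.
move=> e0; have [L [LA LP]] := avoid e0; exists L; split=> // K u cK KL Ku.
have clL n : closed (L n) by apply: compactC_closed; case: (LA n).
have [N NP] := compact_avoid clL cK KL.
have [y Ny xy] := LP N.
have yu : rip u y = 0.
  apply: (specsub_orth ipE bb bc abc cbc cK _ NP Ku Ny); exact: inter_closed.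
rewrite -(subrK y x) ripDl (ripC ip y) yu addr0.
by apply: le_trans (cauchy_schwarz_abs ipE _ _) _; rewrite ler_wpM2r ?nm_ge0.
Qed.

Lemma perp_bigcup : perp x (\bigcup_n A n).
Proof.
apply: (orth_innersub ipE) => K u cK KA Ku.
apply/eqP; rewrite -normr_eq0 eq_le normr_ge0 andbT; apply/ler_addgt0Pl => e e0.
rewrite addr0; have u0 : 0 < nm u + 1 by rewrite ltr_wpDl ?nm_ge0.
have [L [LA LP]] := avoid_orth (divr_gt0 e0 u0).
apply: le_trans (LP K u cK _ Ku) _; last first.
  by rewrite mulrAC ler_pdivrMr // ler_pM2l // lerDl.
by move=> z /KA[n _ Az] /(_ n) Lz; have [_ /(_ z Lz)] := LA n; apply.
Qed.

(** The compact set of common points of the [L n] lies off the union, so [x] is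
    approximated by vectors carried by compact sets that miss it; to these [x] is almost
    orthogonal. *)
Lemma perp_bigcup_eq0 : perp x (~` \bigcup_n A n) -> x = 0.
Proof.
move=> xAc; apply/nm0_eq0/eqP; rewrite eq_le nm_ge0 andbT leNgt; apply/negP => x0.
(* With [u] within [e] of [x], [nm x ^+ 2 <= e * (2 * nm x + e)], absurd for this [e]. *)
pose e := nm x / 4; have e0 : 0 < e by rewrite divr_gt0.
have [L [LA LP]] := avoid_orth e0.
pose K := \bigcap_n L n.
have cK : closed K by apply: closed_bigI => n _; apply: compactC_closed; case: (LA n).
have KA : K `<=` ~` \bigcup_n A n.
  move=> z Kz [n _ Az]; have [_ /(_ z) h] := LA n; apply: h => //; exact: Kz.
have [M [cM MK [u Mu xu]]] :=
  splitting_perp (splitting_closed cK) (perp_mono KA xAc) e0.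
have h1 := LP M u cM (fun z Mz zL => MK z Mz (fun n _ => zL n)) Mu.
have h2 := cauchy_schwarz ipE x (x - u).
have h3 : nm u <= nm x + nm (x - u).
  by have := nmD x (u - x); rewrite addrCA subrr addr0 (nmC u).
have h4 : rip x x = rip x u + rip x (x - u) by rewrite -ripDr addrC subrK.
rewrite -(nm2 ipE) in h4.
have h5 := le_trans (ler_norm _) h1.
have h6 := ler_wpM2l (nm_ge0 x) (ltW xu).
have h7 := ler_wpM2l (ltW e0) h3; have h8 := ler_wpM2l (ltW e0) (ltW xu).
have : 0 < nm x ^+ 2 by rewrite exprn_gt0.
move: h4 h5 h6 h7 h8; rewrite /e; nra.
Qed.

End Sequence.

Lemma splitting_bigcup (A : nat -> set C) :
  (forall n, splitting (A n)) -> splitting (\bigcup_n A n).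
Proof.
move=> sA x xA; apply: perp_bigcup_eq0 => // n.
by apply: perp_mono xA; exact: bigcup_sup.
Qed.

(** By Bessel's inequality the partial sums form a Cauchy sequence; the limit lies in the
    subspace of the union and differs from [x] by a vector orthogonal to that of
    each [A n]. *)
Lemma specproj_sigma (A : nat -> set C) x (e : R) :
  (forall n, splitting (A n)) -> trivIset setT A -> 0 < e ->
  exists N, forall n, (N <= n)%N ->
    nm (\sum_(0 <= i < n) specproj (A i) x - specproj (\bigcup_n A n) x) < e.
Proof.
move=> sA tA; pose u i := specproj (A i) x; pose v n := \sum_(0 <= i < n) u i.
have dis i j z : i != j -> A i z -> A j z -> False.
  move=> ij Ai Aj; move/trivIsetP: tA => /(_ i j I I ij) A0.
  by have : (A i `&` A j) z by []; rewrite A0.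
have uu i j : i != j -> rip (u i) (u j) = 0.
  move=> ij; apply: (@specproj_disj (A i) (A j)) => [z|]; first exact: dis.
  exact: specproj_in.
pose s n := \sum_(0 <= i < n) nm (u i) ^+ 2.
have us m j : (m <= j)%N -> rip (v m) (u j) = 0.
  move=> mj; rewrite rip_suml big_nat big1 // => i /andP[_ im].
  by rewrite uu // ltn_eqF // (leq_trans im).
have vS n : v n.+1 = v n + u n by rewrite /v big_nat_recr.
have sS n : s n.+1 = s n + nm (u n) ^+ 2 by rewrite /s big_nat_recr.
have uv m n : (m <= n)%N -> nm (v n - v m) ^+ 2 = s n - s m.
  move=> /subnKC <-; elim: (n - m)%N => [|k IH].
    by rewrite addn0 !subrr nm0 expr0n.
  rewrite addnS vS sS -addrAC (nmD2 ipE) IH ripDl ripNl us ?leq_addr //.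
  by rewrite us ?leq_addr //; lra.
have s_v n : s n = nm (v n) ^+ 2.
  by have := uv 0 n (leq0n _); rewrite /v /s !(big_geq (leqnn 0)) !subr0 => ->.
have s_x n : s n = rip (v n) x.
  rewrite rip_suml; apply: eq_bigr => i _.
  by rewrite (oproj_rip ipE (specproj_oproj _)).
have s_le n : s n <= nm x ^+ 2.
  have := cauchy_schwarz ipE (v n) x; rewrite -s_x s_v => h.
  have [v0|v0] := eqVneq (nm (v n)) 0; first by rewrite v0 expr0n sqr_ge0.
  have vp : 0 < nm (v n) by rewrite lt_def v0 nm_ge0.
  by rewrite ler_sqr ?nnegrE ?nm_ge0 // -(ler_pM2l vp) -expr2.
have s_mono m n : (m <= n)%N -> s m <= s n.
  by move=> mn; rewrite -subr_ge0 -uv // sqr_ge0.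
have hs : has_sup (range s).
  split; first by exists (s 0%N), 0%N.
  by exists (nm x ^+ 2) => _ [n _ <-].
have s_sup n : s n <= sup (range s) by apply: ub_le_sup; [case: hs|exists n].
have [w wP] : exists l, forall e : R, 0 < e -> exists N, forall n, (N <= n)%N ->
    nm (v n - l) < e.
  apply: nm_complete => r r0; have r2 : 0 < r ^+ 2 by rewrite exprn_gt0.
  have [_ [N _ <-] h] := sup_adherent r2 hs.
  have near m n : (N <= m)%N -> (m <= n)%N -> nm (v n - v m) < r.
    move=> Nm mn; rewrite -ltr_sqr ?nnegrE ?nm_ge0 ?(ltW r0) // uv //.
    have := s_mono _ _ Nm; have := s_sup n; lra.
  exists N => m n Nm Nn; case/orP: (leq_total m n) => mn; last exact: near.
  by rewrite nmC near.
have vA n : innersub (\bigcup_n A n) (v n).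
  apply: sub_sum => // i; apply: innersub_mono (specproj_in _ _).
  exact: bigcup_sup.
suff wE : specproj (\bigcup_n A n) x = w by rewrite wE => /wP.
apply: projOn_uniq => //.
  apply: (sub_closed (cI _)) => r /wP[N NP]; exists (v N) => //.
  by rewrite nmC NP.
apply: perp_bigcup => // j y Ay.
apply/eqP; rewrite -normr_eq0 eq_le normr_ge0 andbT; apply/ler_addgt0Pl => r r0.
rewrite addr0; have y0 : 0 < nm y + 1 by rewrite ltr_wpDl ?nm_ge0.
have [N NP] := wP _ (divr_gt0 r0 y0).
pose n := maxn N j.+1; have nw := NP n (leq_maxl _ _).
have -> : rip (x - w) y = rip (v n - w) y.
  suff -> : x - w = (v n - w) + (x - v n).
    rewrite ripDl [X in _ + X](_ : _ = 0) ?addr0 // ripDl ripNl /v rip_suml.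
    rewrite (bigD1_seq j) ?mem_index_iota ?iota_uniq ?leq_maxr //= big1 => [|i ij].
      by rewrite addr0 -ripNl -ripDl; apply: specproj_perp.
    exact: (@specproj_disj (A i) (A j) x (fun z => @dis i j z ij) y Ay).
  by rewrite [RHS]addrC addrA subrK.
apply: le_trans (cauchy_schwarz_abs ipE _ _) _.
apply: le_trans (ler_wpM2r (nm_ge0 _) (ltW nw)) _.
by rewrite mulrAC ler_pdivrMr // ler_pM2l // lerDl.
Qed.

End Splitting.

(** * Step functions against an additive family of projections *)

Section StepIntegral.
Variables (R : realType) (H : completeNormedModType R[i]).
Variables (ip : {dot H for Num.conj}) (ipE : hilbert_form ip).
Variables (Omega : Type) (E : set (set Omega)) (Q : set Omega -> H -> H).
Hypothesis Esigma : sigma_algebra setT E.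
Hypothesis QP : forall A, E A -> oproj ip (Q A).
Hypothesis QT : forall x, Q setT x = x.
Hypothesis QU : forall A B, E A -> E B -> (forall z, A z -> B z -> False) ->
  forall x, Q (A `|` B) x = Q A x + Q B x.
Implicit Types (x y : H) (A B : set Omega) (h k : Omega -> R[i]^o).
Local Notation rip := (rip ip).

Lemma meas0 : E set0. Proof. by case: Esigma. Qed.

Lemma measC A : E A -> E (~` A).
Proof. by case: Esigma => _ EC _ /EC; rewrite setTD. Qed.

Lemma meas_bigcup (F : nat -> set Omega) : (forall n, E (F n)) -> E (\bigcup_n F n).
Proof. by case: Esigma => _ _; apply. Qed.

Lemma measU A B : E A -> E B -> E (A `|` B).
Proof.
move=> EA EB; rewrite -bigcup2E; apply: meas_bigcup => -[|[|n]] //=.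
exact: meas0.
Qed.

Lemma measI A B : E A -> E B -> E (A `&` B).
Proof.
move=> EA EB; rewrite -[A `&` B]setCK setCI.
by apply: measC; apply: measU; exact: measC.
Qed.

Lemma measT : E setT.
Proof. by rewrite -setC0; apply: measC; exact: meas0. Qed.

Lemma proj0 x : Q set0 x = 0.
Proof.
have := QU meas0 meas0 (fun z (a : set0 z) => match a with end) x.
rewrite setUid => /(congr1 (+%R^~ (- Q set0 x))).
by rewrite subrr addrK.
Qed.

(** For [y] in the range of [Q B], additivity gives
    [nm (Q A y) ^+ 2 + nm y ^+ 2 = nm (Q (A `|` B) y) ^+ 2 <= nm y ^+ 2]. *)
Lemma proj_disj A B x : E A -> E B -> (forall z, A z -> B z -> False) ->
  Q A (Q B x) = 0.
Proof.
move=> EA EB AB; have EU := measU EA EB; set y := Q B x.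
have yB : Q B y = y by exact: (oproj_idem (QP EB)).
have := oproj_nm ipE (QP EU) y => h.
have h2 : nm (Q (A `|` B) y) ^+ 2 <= nm y ^+ 2.
  by rewrite ler_sqr ?nnegrE ?nm_ge0.
rewrite -(oproj_rip ipE (QP EU)) QU // ripDl !(oproj_rip ipE) in h2; try exact: QP.
apply: nm0_eq0; apply/eqP; rewrite -sqrf_eq0 eq_le sqr_ge0 andbT.
by move: h2; rewrite yB; lra.
Qed.

Lemma projI A B x : E A -> E B -> Q A (Q B x) = Q (A `&` B) x.
Proof.
move=> EA EB; have EAB := measI EA EB; have EnA := measI (measC EA) EB.
have {1}-> : Q B x = Q (A `&` B) x + Q (~` A `&` B) x.
  rewrite -QU // => [|z [Az _] [nAz _] //].
  by rewrite -setIUl setUCr setTI.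
have EnAB := measI EA (measC EB).
rewrite (linopD (oproj_lin (QP EA))) (proj_disj _ EA EnA) ?addr0; last first.
  by move=> z Az [].
have -> : Q A (Q (A `&` B) x) =
    Q (A `&` B) (Q (A `&` B) x) + Q (A `&` ~` B) (Q (A `&` B) x).
  rewrite -QU // => [|z [_ Bz] [_ nBz] //].
  by rewrite -setIUr setUCr setIT.
rewrite (proj_disj _ EnAB EAB) ?addr0; last by move=> z [_ nBz] [_ /nBz].
exact: (oproj_idem (QP EAB)).
Qed.

Lemma proj_comm A B x : E A -> E B -> Q A (Q B x) = Q B (Q A x).
Proof. by move=> EA EB; rewrite !projI // setIC. Qed.

Local Notation mstep := (@measurable_step R Omega E).

Lemma preimage_cons h c (s : seq R[i]^o) :
  h @^-1` [set` c :: s] = h @^-1` [set c] `|` h @^-1` [set` s].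
Proof.
apply/seteqP; split=> z /=; rewrite inE.
  by case/orP => [/eqP ->|]; [left|right].
by case=> [->|->]; rewrite ?eqxx ?orbT.
Qed.

Lemma step_pre h (s : seq R[i]^o) : mstep h -> E (h @^-1` [set` s]).
Proof.
move=> [_ Eh]; elim: s => [|c s IH].
  by rewrite (_ : _ @^-1` _ = set0) ?set_nil ?preimage_set0 //; exact: meas0.
by rewrite preimage_cons; apply: measU.
Qed.

Lemma proj_seq h (s : seq R[i]^o) x : mstep h -> uniq s ->
  \sum_(c <- s) Q (h @^-1` [set c]) x = Q (h @^-1` [set` s]) x.
Proof.
move=> mh; have [_ Eh] := mh; elim: s => [|c s IH] /=.
  by rewrite big_nil set_nil preimage_set0 proj0.
move=> /andP[cs us]; rewrite big_cons IH // preimage_cons QU //.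
  exact: step_pre.
by move=> z /= ->; rewrite (negPf cs).
Qed.

Definition values h : seq R[i]^o := fset_set (range h).

Lemma values_mem h z : mstep h -> h z \in values h.
Proof. by case=> fh _; rewrite in_fset_set //; apply: mem_set; exists z. Qed.

Lemma values_uniq h : uniq (values h).
Proof. exact: fset_uniq. Qed.

Lemma proj_cover h x : mstep h -> \sum_(c <- values h) Q (h @^-1` [set c]) x = x.
Proof.
move=> mh; rewrite proj_seq // ?values_uniq // (_ : _ @^-1` _ = setT) ?QT //.
by apply/seteqP; split=> z //= _; exact: values_mem.
Qed.

Definition stepint h x := \sum_(c <- values h) c *: Q (h @^-1` [set c]) x.

Lemma stepint_local h B d x : mstep h -> E B -> (forall z, B z -> h z = d) ->
  Q B (stepint h x) = d *: Q B x.
Proof.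
move=> mh EB Bd; have [_ Eh] := mh; have lB := oproj_lin (QP EB).
rewrite /stepint (linop_sum lB) -[in RHS](proj_cover x mh) (linop_sum lB) scaler_sumr.
apply: eq_bigr => c _; rewrite (linopZ lB) projI //.
have [->//|cd] := eqVneq c d.
rewrite (_ : B `&` _ = set0) ?proj0 ?scaler0 //.
apply/seteqP; split=> z //= [/Bd -> dc]; by rewrite dc eqxx in cd.
Qed.

Lemma proj_sep h x y : mstep h ->
  (forall c, Q (h @^-1` [set c]) x = Q (h @^-1` [set c]) y) -> x = y.
Proof.
by move=> mh xy; rewrite -(proj_cover x mh) -(proj_cover y mh); apply: eq_bigr.
Qed.

Lemma mstep_lin (a : R[i]) h k : mstep h -> mstep k -> mstep (a *: h + k).
Proof.
move=> mh mk; have [fh Eh] := mh; have [fk Ek] := mk; split.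
  apply: (@sub_finite_set _ _ [set a * u + v | u in range h & v in range k]).
    by move=> _ [z _ <-]; exists (h z); [exists z|exists (k z); [exists z|]].
  exact: finite_image2.
move=> c; have -> : (a *: h + k) @^-1` [set c] =
    \bigcup_(u in [set` values h]) (h @^-1` [set u] `&` k @^-1` [set c - a * u]).
  apply/seteqP; split=> z /=.
    move=> zc; exists (h z); first exact: values_mem.
    by split=> //=; rewrite -zc addrC addKr.
  by move=> [u _ [/= <- kz]]; rewrite -[LHS]/(a * h z + k z) kz addrC subrK.
rewrite bigcup_seq; elim/big_ind: _ => [||u _]; [exact: meas0|exact: measU|].
exact: measI.
Qed.

Lemma mstep_indic A : E A -> mstep (\1_A).
Proof.
move=> EA; split.
  apply: (@sub_finite_set _ _ [set` [:: 0; 1]]) => [_ [z _ <-]|].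
    by rewrite /= indicE; case: (z \in A); rewrite !inE eqxx ?orbT.
  exact: finite_seq.
move=> c; have -> : (\1_A : Omega -> R[i]^o) @^-1` [set c] =
    (if c == 1 then A else set0) `|` (if c == 0 then ~` A else set0).
  apply/seteqP; split=> z /=.
    rewrite indicE; have [Az|nAz] := pselect (A z).
      by rewrite mem_set //= => <-; left; rewrite eqxx.
    by rewrite memNset //= => <-; right; rewrite eqxx.
  case; case: eqP => // -> Az; rewrite indicE; first by rewrite mem_set.
  by rewrite memNset.
by apply: measU; case: ifP => _ //; [exact: meas0|exact: measC|exact: meas0].
Qed.

(** Both sides agree on the common level sets of [h] and [k], which cover the space. *)
Lemma stepint_lin (a : R[i]) h k x : mstep h -> mstep k ->
  stepint (a *: h + k) x = a *: stepint h x + stepint k x.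
Proof.
move=> mh mk; have ms := mstep_lin a mh mk.
have [_ Eh] := mh; have [_ Ek] := mk.
apply: (proj_sep mh) => c; apply: (proj_sep mk) => d.
rewrite !projI //; set B := _ `&` _; have EB : E B by exact: measI.
have lB := oproj_lin (QP EB).
rewrite (linopD lB) (linopZ lB) (stepint_local (d := a * c + d)) //; last first.
  by move=> z [/= kz hz]; rewrite -kz -hz.
rewrite (stepint_local (d := c)) // => [|z [_ ->] //].
by rewrite (stepint_local (d := d)) // => [|z [-> _] //]; rewrite scalerA scalerDl.
Qed.

Lemma stepint_indic A x : E A -> stepint (\1_A) x = Q A x.
Proof.
move=> EA; have m1 := mstep_indic EA; have [_ E1] := m1.
apply: (proj_sep m1) => c; rewrite (stepint_local (d := c)) // projI //.
have [->|c1] := eqVneq c 1.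
  rewrite scale1r; congr (Q _ x); apply/seteqP; split=> z /=; last by case.
  rewrite indicE; have [Az|nAz] := pselect (A z); first by rewrite mem_set.
  by rewrite memNset //= => /eqP; rewrite eq_sym oner_eq0.
have -> : (\1_A : Omega -> R[i]^o) @^-1` [set c] `&` A = set0.
  apply/seteqP; split=> z //= [+ Az]; rewrite indicE mem_set //= => c1'.
  by rewrite -c1' eqxx in c1.
have [->|c0] := eqVneq c 0; first by rewrite scale0r proj0.
rewrite (_ : _ @^-1` _ = set0) ?proj0 ?scaler0 //.
apply/seteqP; split=> z //=; rewrite indicE; case: (_ \in _) => /= e.
  by rewrite -e eqxx in c1.
by rewrite -e eqxx in c0.
Qed.

(** A step function is a finite linear combination of the indicators of its level sets, so
    linearity leaves no choice. *)
Lemma step_integral_uniq (I : (Omega -> R[i]^o) -> H -> H) h :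
  is_step_integral E Q I -> mstep h -> I h = stepint h.
Proof.
move=> [I1 IL] mh; have [_ Eh] := mh.
pose g (s : seq R[i]^o) : Omega -> R[i]^o :=
  \sum_(c <- s) c *: (\1_(h @^-1` [set c]) : Omega -> R[i]^o).
have m0 : mstep 0.
  by have := mstep_indic meas0; rewrite indic0.
have I0 : I 0 = 0.
  by have := I1 _ meas0; rewrite indic0 => ->; apply/funext => x; rewrite proj0.
have mg s : mstep (g s).
  rewrite /g; elim: s => [|c s IH]; first by rewrite big_nil.
  by rewrite big_cons; apply: mstep_lin => //; exact: mstep_indic.
have Ig s : I (g s) = \sum_(c <- s) c *: Q (h @^-1` [set c]).
  elim: s => [|c s IH]; first by rewrite /g !big_nil.
  have -> : g (c :: s) = c *: (\1_(h @^-1` [set c]) : Omega -> R[i]^o) + g s.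
    by rewrite /g big_cons.
  by rewrite IL ?I1 ?IH ?big_cons //; exact: mstep_indic.
have hg : h = g (values h).
  apply/funext => z; rewrite /g fct_sumE.
  rewrite (bigD1_seq (h z)) ?values_mem ?values_uniq //= big1 ?addr0.
    by rewrite -[RHS]/(h z * \1_(h @^-1` [set h z]) z) indicE mem_set // mulr1.
  move=> c /eqP cz; rewrite -[LHS]/(c * \1_(h @^-1` [set c]) z) indicE memNset.
    by rewrite mulr0.
  by move=> /= hzc; apply: cz.
rewrite [in LHS]hg Ig; apply/funext => x.
by rewrite fct_sumE.
Qed.

End StepIntegral.

(** * Subspaces of the plane *)

Section Subtype.
Variables (R : realType) (S : set (R[i]^o)).
Local Notation C := (R[i]^o).
Implicit Types (A : set S) (z : S).

Lemma sub_open A : open A -> exists2 V : set C, open V & A = set_val @^-1` V.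
Proof. by case=> V oV <-; exists V. Qed.

Lemma sub_open_pre (V : set C) : open V -> open (set_val @^-1` V : set S).
Proof. by move=> oV; exists V. Qed.

Lemma set_val_cont : continuous (set_val : S -> C).
Proof. exact: initial_continuous. Qed.

Lemma sub_point w : S w -> exists z : S, set_val z = w.
Proof. by move=> Sw; exists (SigSub (mem_set Sw)). Qed.

Lemma set_val_inj (z z' : S) : set_val z = set_val z' -> z = z'.
Proof. by move=> zz; apply/val_inj. Qed.

Lemma sub_compact (K : set C) : compact K -> K `<=` S ->
  compact (set_val @^-1` K : set S).
Proof.
move=> cK KS F PF FK.
have [|k [Kk kF]] := cK (set_val @ F) _ _; first exact: FK.
have [z zk] := sub_point (KS k Kk).
exists z; split; first by rewrite /= zk.
move=> A B FA; rewrite nbhsE => -[U [oU Uz] UB].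
have [V oV UV] := sub_open oU.
have nV : nbhs k V by apply: open_nbhs_nbhs; split=> //; rewrite -zk; rewrite UV in Uz.
have FA' : (set_val @ F) (set_val @` A).
  by apply: (@filterS _ F _ A) => // a Aa; exists a.
have [_ [[a Aa <-] Va]] := kF _ _ FA' nV.
by exists a; split=> //; apply: UB; rewrite UV.
Qed.

Lemma sub_compact_image A : compact A -> compact (set_val @` A : set C).
Proof.
move=> cA; apply: continuous_compact => //.
by apply: continuous_subspaceT; exact: set_val_cont.
Qed.

Lemma sub_hausdorff : hausdorff_space S.
Proof.
move=> p q pq; apply: set_val_inj.
apply: (@norm_hausdorff _ C) => U V Up Vq.
have [a [Ua Va]] := pq _ _ (@set_val_cont p _ Up) (@set_val_cont q _ Vq).
by exists (set_val a).
Qed.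

Lemma image_setT : set_val @` [set: S] = S.
Proof.
apply/seteqP; split=> [_ [z _ <-]|w /sub_point[z <-]]; last by exists z.
exact: set_valP.
Qed.

Lemma image_setC A : set_val @` (~` A) = S `&` ~` (set_val @` A).
Proof.
apply/seteqP; split=> [_ [z nAz <-]|w [/sub_point[z <-] nAz]].
  by split; [exact: set_valP|move=> [z' Az' /set_val_inj zz]; rewrite zz in Az'].
by exists z => // Az; apply: nAz; exists z.
Qed.

Lemma image_val_preimage (V : set C) : set_val @` (set_val @^-1` V : set S) = S `&` V.
Proof.
apply/seteqP; split=> [_ [z Vz <-]|w [/sub_point[z <-] Vz]]; last by exists z.
by split=> //; exact: set_valP.
Qed.

End Subtype.

(** * The spectral measure *)

Section SpectralMeasure.
Variables (R : realType) (H : completeNormedModType R[i]).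
Variables (ip : {dot H for Num.conj}) (ipE : hilbert_form ip).
Variables (b c : H -> H).
Hypotheses (bb : bounded_op b) (bc : bounded_op c) (abc : adj ip b c).
Hypothesis cbc : comm c b.
Local Notation C := (R[i]^o).
Local Notation Om := (spectrum b).
Implicit Types (x y : H) (A B : set Om).
Local Notation rip := (rip ip).
Local Notation specsub := (specsub ip b).
Local Notation innersub := (innersub ip b).
Local Notation splitting := (splitting ip b).
Local Notation borel := (@borel Om).

Definition spectral_proj A : H -> H := specproj ip b (set_val @` A).

Lemma splittingU (A B : set C) : splitting A -> splitting B -> splitting (A `|` B).
Proof.
move=> sA sB; rewrite -bigcup2E; apply: (splitting_bigcup ipE bb bc abc cbc).
move=> [|[|n]] //=; apply: (splitting_closed ipE bb bc abc cbc); exact: closed0.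
Qed.

Lemma splittingI (A B : set C) : splitting A -> splitting B -> splitting (A `&` B).
Proof.
move=> sA sB; rewrite -[A `&` B]setCK setCI.
by apply/splittingC/splittingU; exact: splittingC.
Qed.

Lemma borel_sigma : sigma_algebra setT borel.
Proof. exact: smallest_sigma_algebra. Qed.

Lemma splitting_spectrum : splitting (spectrum b).
Proof.
exact: (splitting_closed ipE bb bc abc cbc (spectrum_closed ipE bb bc abc cbc)).
Qed.

(** Relatively open sets are intersections of the closed spectrum with open sets, and the
    splitting sets form a sigma-algebra. *)
Lemma splitting_borel A : borel A -> splitting (set_val @` A).
Proof.
move: A; apply: smallest_sub.
  split.
  - rewrite /= image_set0; apply: (splitting_closed ipE bb bc abc cbc).
    exact: closed0.
  - move=> A sA; rewrite /= setTD image_setC.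
    by apply: splittingI; [exact: splitting_spectrum|exact: splittingC].
  - move=> F sF; rewrite /= image_bigcup.
    exact: (splitting_bigcup ipE bb bc abc cbc).
move=> A /sub_open[V oV ->]; rewrite /= image_val_preimage.
apply: splittingI; first exact: splitting_spectrum.
rewrite -[V]setCK; apply: splittingC.
exact: (splitting_closed ipE bb bc abc cbc (open_closedC oV)).
Qed.

Lemma spectral_proj_oproj A : oproj ip (spectral_proj A).
Proof. exact: specproj_oproj. Qed.

Lemma spectral_projT x : spectral_proj setT x = x.
Proof.
rewrite /spectral_proj image_setT; apply: specproj_id => //.
apply: (specsub_innersub ipE bb bc abc cbc).
  exact: (spectrum_closed ipE bb bc abc cbc).
exact: (specsub_spectrum ipE bb bc abc cbc).
Qed.

Lemma image_disj A B : (forall z, A z -> B z -> False) ->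
  forall w, (set_val @` A) w -> (set_val @` B) w -> False.
Proof.
move=> AB _ [z Az <-] [z' Bz' /set_val_inj zz]; apply: (AB z) => //.
by rewrite -zz.
Qed.

Lemma spectral_projU A B : borel A -> borel B ->
  (forall z, A z -> B z -> False) ->
  forall x, spectral_proj (A `|` B) x = spectral_proj A x + spectral_proj B x.
Proof.
move=> mA mB AB x; have sA := splitting_borel mA; have sB := splitting_borel mB.
have disj := image_disj AB.
have cI F := innersub_closed ipE b F.
rewrite /spectral_proj image_setU; apply: projOn_uniq => //.
  apply: (subD (cI _)).
    by apply: (innersub_mono (@subsetUl _ _ _)); exact: specproj_in.
  by apply: (innersub_mono (@subsetUr _ _ _)); exact: specproj_in.
set y := x - _.
have pA : perp ip b y (set_val @` A).
  rewrite /y opprD addrA; apply: perpB; first exact: specproj_perp.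
  by apply: (specproj_disj ipE bb bc abc cbc) => z Bz /disj; apply.
have pB : perp ip b y (set_val @` B).
  rewrite /y opprD addrA addrAC; apply: perpB; first exact: specproj_perp.
  by apply: (specproj_disj ipE bb bc abc cbc) => z Az /(disj z Az).
rewrite -bigcup2E; apply: (perp_bigcup ipE bb bc abc cbc) => -[|[|n]] //=.
  by apply: (splitting_closed ipE bb bc abc cbc); exact: closed0.
exact: perp_mono (@sub0set _ _) pA.
Qed.

Lemma spectral_valueE A x :
  spectral_value ip spectral_proj x A = (nm (spectral_proj A x) ^+ 2)%:E.
Proof.
by rewrite /spectral_value -(oproj_rip ipE (spectral_proj_oproj A)).
Qed.

Lemma spectral_proj_measure x : measure_on borel (spectral_value ip spectral_proj x).
Proof.
split=> [|A _|F mF tF].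
- rewrite spectral_valueE (proj0 borel_sigma spectral_projU).
  by rewrite nm0 expr0n.
- by rewrite spectral_valueE lee_fin sqr_ge0.
pose v n := \sum_(0 <= i < n) spectral_proj (F i) x.
pose l := spectral_proj (\bigcup_n F n) x.
have vl (e : R) : 0 < e -> exists N, forall n, (N <= n)%N -> nm (v n - l) < e.
  move=> e0; rewrite /v /l /spectral_proj image_bigcup.
  apply: (specproj_sigma ipE bb bc abc cbc) => // [n|]; first exact: splitting_borel.
  apply/trivIsetP => i j _ _ ij; apply/seteqP; split=> // w [].
  apply: image_disj => z Fi Fj; move/trivIsetP: tF => /(_ i j I I ij) F0.
  by have : (F i `&` F j) z by []; rewrite F0.
have -> : (fun n => (\sum_(0 <= i < n) spectral_value ip spectral_proj x (F i))%E) =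
    EFin \o (fun n => rip (v n) x).
  by apply/funext => n /=; rewrite sumEFin rip_suml.
rewrite /spectral_value -/l; apply: cvg_EFin; first exact: nearW.
apply/cvgrPdist_le => e e0.
have x0 : 0 < nm x + 1 by rewrite ltr_wpDl ?nm_ge0.
have [N NP] := vl _ (divr_gt0 e0 x0).
exists N => // n /= /NP vn.
rewrite -/(rip l x) -ripNl -ripDl.
apply: le_trans (cauchy_schwarz_abs ipE _ _) _; rewrite nmC.
apply: le_trans (ler_wpM2r (nm_ge0 _) (ltW vn)) _.
by rewrite mulrAC ler_pdivrMr // ler_pM2l // lerDl.
Qed.

End SpectralMeasure.

Section SpectralTheorem.
Variables (R : realType) (H : completeNormedModType R[i]).
Variables (ip : {dot H for Num.conj}) (ipE : hilbert_form ip).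
Variables (b c : H -> H).
Hypotheses (bb : bounded_op b) (bc : bounded_op c) (abc : adj ip b c).
Hypothesis cbc : comm c b.
Local Notation C := (R[i]^o).
Local Notation Om := (spectrum b).
Implicit Types (x y : H) (A B : set Om).
Local Notation rip := (rip ip).
Local Notation specsub := (specsub ip b).
Local Notation innersub := (innersub ip b).
Local Notation borel := (@borel Om).
Local Notation P := (spectral_proj ip (b := b)).

Let linb : linear b := bounded_linear bb.

Lemma spectral_proj_mono A B x : A `<=` B ->
  P A (P B x) = P A x.
Proof.
move=> AB; have lA := oproj_lin (spectral_proj_oproj ipE A).
apply/eqP; rewrite -subr_eq0 -(linopB lA) -oppr_eq0 -(linopN lA) opprB.
apply/eqP; apply: (specproj_eq0 ipE).
apply: (@perp_mono _ _ ip b _ (set_val @` B)); first exact: image_subset.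
exact: specproj_perp.
Qed.

Lemma spectral_proj_le A B x : A `<=` B -> nm (P A x) <= nm (P B x).
Proof.
move=> AB; rewrite -(spectral_proj_mono x AB).
exact: (oproj_nm ipE (spectral_proj_oproj ipE A)).
Qed.

Lemma spectral_proj_regular A x (e : R) : 0 < e ->
  exists K, [/\ compact K, K `<=` A & nm (P A x - P K x) < e].
Proof.
move=> e0; have [L [cL LA [y Ly xy]]] := specproj_in ipE b (set_val @` A) x e0.
have LS : L `<=` spectrum b.
  by move=> w /LA[z _ <-]; exact: set_valP.
pose K : set Om := set_val @^-1` L.
have KA : K `<=` A.
  by move=> z /LA[z' Az' /set_val_inj <-].
have KL : set_val @` K = L by rewrite image_val_preimage; apply/setIidPr.
exists K; split=> //; first exact: sub_compact.
rewrite -(spectral_proj_mono x KA).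
apply: le_lt_trans xy; rewrite /spectral_proj KL.
exact: (@specproj_near _ _ _ ipE _ _ _ L).
Qed.

Lemma spectral_resolution : (exists x : H, x != 0) ->
  resolution_of_identity ip (P : set Om -> H -> H).
Proof.
move=> H0; split.
- move=> z _; exists setT; first exact: filterT.
  split; last exact: closedT.
  rewrite -[setT]/(set_val @^-1` setT) (_ : _ @^-1` _ = set_val @^-1` (spectrum b)).
    exact: sub_compact (spectrum_compact ipE bb bc abc cbc) _.
  by apply/seteqP; split=> w // _; exact: set_valP.
- exact: sub_hausdorff.
- split.
  + have [w wb] := spectrum_neq0 ipE bb bc abc cbc H0.
    by have [z _] := sub_point wb; exists z.
  + exact: borel_sigma.
  + by move=> A _; apply/(oprojE ipE)/spectral_proj_oproj.
  + by apply/funext => x; exact: (spectral_projT ipE bb bc abc cbc).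
  + exact: (spectral_proj_measure ipE bb bc abc cbc).
- move=> x A _; apply/eqP; rewrite eq_le; apply/andP; split; last first.
    apply: ge_ereal_sup => _ [K [KA _] <-].
    rewrite !(spectral_valueE ipE) lee_fin ler_sqr ?nnegrE ?nm_ge0 //.
    exact: spectral_proj_le.
  apply/lee_addgt0Pr => e e0; rewrite (spectral_valueE ipE).
  pose r := e / (2 * nm x + 1).
  have r0 : 0 < r by rewrite divr_gt0 // ltr_wpDl // mulr_ge0 ?nm_ge0.
  have [K [cK KA xK]] := spectral_proj_regular A x r0.
  apply: (@le_trans _ _ ((nm (P K x) ^+ 2)%:E + e%:E)%E); last first.
    apply: leeD => //; apply: ereal_sup_ubound; exists K => //.
    by rewrite (spectral_valueE ipE).
  rewrite -EFinD lee_fin.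
  have h1 := nmB_ge (P A x) (P K x).
  have h2 := oproj_nm ipE (spectral_proj_oproj ipE A) x.
  have h3 := spectral_proj_le x KA.
  have h4 : r * (2 * nm x + 1) = e.
    by rewrite divfK // gt_eqF // ltr_wpDl // mulr_ge0 ?nm_ge0.
  have h5 := nm_ge0 (P K x); have h6 := nm_ge0 x.
  have h7 : nm (P A x) - nm (P K x) <= r by exact: le_trans h1 (ltW xK).
  have h8 : 0 <= nm (P A x) - nm (P K x) by rewrite subr_ge0.
  have := ler_pM h8 (addr_ge0 (nm_ge0 (P A x)) h5) h7
    (_ : nm (P A x) + nm (P K x) <= 2 * nm x).
  rewrite -subr_sqr => h9; have : nm (P A x) + nm (P K x) <= 2 * nm x by lra.
  by move=> /h9; lra.
Qed.

(** An open set with a point of the spectrum contains a disc of the spectrum, whose spectral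
    subspace is not zero. *)
Lemma spectral_support : is_support (P : set Om -> H -> H) setT.
Proof.
exists set0; split.
- split; first exact: open0.
  apply/funext => x; apply: (proj0 (borel_sigma b)).
  exact: (spectral_projU ipE bb bc abc cbc).
- move=> V [oV PV] z Vz.
  have [W oW VW] := sub_open oV.
  have /nbhs_cabs[e e0 eW] : nbhs (set_val z) W.
    by apply: open_nbhs_nbhs; split=> //; rewrite VW in Vz.
  have e20 : 0 < e / 2 by rewrite divr_gt0.
  have [y Ky] := spectrum_charged ipE bb bc abc cbc (set_valP z) e20.
  case; rewrite -[LHS](specproj_id (A := set_val @` V) ipE (b := b)).
    by have := congr1 (@^~ y) PV.
  apply: innersubI Ky.
    apply: compact_closedI; first exact: cdisc_compact.
    exact: (spectrum_closed ipE bb bc abc cbc).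
  rewrite VW image_val_preimage => w [wz wb]; split=> //; apply: eW.
  by apply: le_lt_trans wz _; lra.
- by rewrite setC0.
Qed.

(** * Integration of the identity *)

(** At a point far from all centres [b - w] would be bounded below on every cell, hence
    everywhere. *)
Lemma spectrum_net (e : R) : 0 < e -> exists n (z : nat -> R[i]),
  forall w, spectrum b w -> exists2 i, (i < n)%N & cabs (w - z i) <= e.
Proof.
move=> e0; pose d := e / 2; have d0 : 0 < d by rewrite divr_gt0.
have [n [z [q [zq qE]]]] := partition_exists ipE bb bc abc cbc d0.
have qP i : oproj ip (q i) by case: (zq i).
exists n, z => w wb; apply: contrapT => far.
apply: (@bounded_below_resolvent _ _ _ ipE b c bb bc abc cbc w d) wb => //.
move=> y; rewrite -ler_sqr ?nnegrE ?nm_ge0 ?mulr_ge0 ?nm_ge0 ?(ltW d0) ?(ltW e0) //.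
rewrite exprMn !(partition_nm ipE qP qE) mulr_sumr.
rewrite big_nat [leRHS]big_nat; apply: ler_sum => i /andP[_ iN].
rewrite -exprMn ler_sqr ?nnegrE ?nm_ge0 ?mulr_ge0 ?nm_ge0 ?(ltW d0) ?(ltW e0) //.
have [_ qb qd] := zq i; have lq := oproj_lin (qP i).
rewrite (linopB lq) (linopZ lq) qb.
have zw : e < cabs (z i - w).
  by rewrite ltNge; apply/negP => zw; apply: far; exists i => //; rewrite cabsC.
have := nmB_ge ((z i - w) *: q i y) (- (b (q i y) - z i *: q i y)).
rewrite nmN nmZ opprK (_ : _ *: _ + _ = b (q i y) - w *: q i y); last first.
  by rewrite scalerBl addrC addrA subrK.
move=> h; have := qd y; have := ler_wpM2r (nm_ge0 (q i y)) (ltW zw).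
by move: h; rewrite /d; lra.
Qed.

Lemma borel_open A : open A -> borel A.
Proof. exact: sub_gen_smallest. Qed.

Lemma borel_disc w (e : R) : borel [set z : Om | cabs (set_val z - w) <= e].
Proof.
have -> : [set z : Om | cabs (set_val z - w) <= e] = set_val @^-1` (cdisc w e) by [].
rewrite -[cdisc w e]setCK preimage_setC.
apply: (measC (borel_sigma b)); apply: borel_open.
exact: (@sub_open_pre R (spectrum b) _ (closed_openC (@cdisc_closed R w e))).
Qed.

(** Each point is sent to one of the finitely many centres near it; the discs about the
    centres are added one at a time, the last one taking precedence. *)
Lemma step_approx (e : R) : 0 < e -> exists2 h : Om -> C,
  measurable_step borel h & forall z, cabs (h z - set_val z) <= e.
Proof.
move=> /spectrum_net[n [u uP]].
have [h mh hP] : exists2 h : Om -> C, measurable_step borel h &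
    forall z i, (i < n)%N -> cabs (set_val z - u i) <= e ->
    cabs (h z - set_val z) <= e.
  elim: n {uP} => [|n [h mh hP]].
    exists 0 => //; have := mstep_indic R (borel_sigma b) (meas0 (borel_sigma b)).
    by rewrite indic0.
  pose D := [set z : Om | cabs (set_val z - u n) <= e].
  exists (fun z => if z \in D then u n else h z).
    have [fh Eh] := mh; split.
      apply: (@sub_finite_set _ _ (range h `|` [set u n])).
        by move=> _ [z _ <-]; case: ifP => _; [right|left; exists z].
      by rewrite finite_setU; split.
    move=> v; have -> : (fun z => if z \in D then u n else h z) @^-1` [set v] =
        (D `&` (if u n == v then setT else set0)) `|` (~` D `&` h @^-1` [set v]).
      apply/seteqP; split=> z /=.
        have [Dz|nDz] := pselect (D z); first rewrite mem_set // => <-.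
          by left; rewrite eqxx.
        by rewrite memNset // => hz; right.
      move=> [[Dz]|[nDz hz]].
        by rewrite mem_set //; case: eqP.
      by rewrite memNset.
    apply: (measU (borel_sigma b)); apply: (measI (borel_sigma b)) => //.
    - exact: borel_disc.
    - by case: ifP => _; [exact: measT (borel_sigma b)|exact: meas0 (borel_sigma b)].
    - by apply: (measC (borel_sigma b)); exact: borel_disc.
  move=> z i; rewrite ltnS leq_eqVlt => /orP[/eqP ->|iN] zi.
    by rewrite mem_set // cabsC.
  case: ifPn => [/set_mem|_]; last exact: hP iN zi.
  by rewrite /D /= cabsC.
exists h => // z; have [i iN zi] := uP _ (set_valP z).
exact: hP iN zi.
Qed.

End SpectralTheorem.

Section Norms.
Variable R : realType.

Lemma opnorm_le (H : normedModType R[i]) (T : H -> H) (r : R) : linear T ->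
  (forall x, nm (T x) <= r * nm x) -> 0 <= r -> opnorm T <= r.
Proof.
move=> lT Tr r0; apply: ge_sup; first by exists (nm (T 0)), 0 => //=; rewrite normr0.
move=> _ [x /= x1 <-]; apply: le_trans (Tr x) _.
by rewrite ler_piMr // -lecR -nmE.
Qed.

Lemma opnorm_bound (H : normedModType R[i]) (T : H -> H) (M : R) x : linear T ->
  (forall x, nm (T x) <= M * nm x) -> nm (T x) <= opnorm T * nm x.
Proof.
move=> lT TM; have [x0|x0] := eqVneq (nm x) 0.
  by rewrite (nm0_eq0 x0) (linop0 lT) nm0 mulr0.
have xp : 0 < nm x by rewrite lt_def x0 nm_ge0.
rewrite -ler_pdivrMr //; apply: ub_le_sup.
  exists `|M| => _ [y /= y1 <-]; apply: le_trans (TM y) _.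
  have y1' : nm y <= 1 by rewrite -lecR -nmE.
  apply: (@le_trans _ _ (`|M| * nm y)); first by rewrite ler_wpM2r ?nm_ge0 ?ler_norm.
  by rewrite ler_piMr.
exists ((nm x)^-1%:C *: x).
  rewrite /= nmE nmZ cabs_real ger0_norm ?invr_ge0 ?nm_ge0 // mulVf ?gt_eqF //.
rewrite -/(nm _) (linopZ lT) nmZ cabs_real ger0_norm ?invr_ge0 ?nm_ge0 //.
by rewrite mulrC.
Qed.

Lemma supnorm_le (Omega : Type) (f : Omega -> R[i]^o) (r : R) : [set: Omega] !=set0 ->
  (forall z, cabs (f z) <= r) -> supnorm f <= r.
Proof.
move=> [z _] fr; apply: ge_sup; first by exists (cabs (f z)), z.
by move=> _ [w _ <-]; exact: fr.
Qed.

Lemma supnorm_ge (Omega : Type) (f : Omega -> R[i]^o) (M : R) z :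
  (forall z, cabs (f z) <= M) -> cabs (f z) <= supnorm f.
Proof.
move=> fM; apply: ub_le_sup; last by exists z.
by exists M => _ [w _ <-]; exact: fM.
Qed.

Lemma mstep_bounded (Omega : Type) (E : set (set Omega)) (h : Omega -> R[i]^o) :
  measurable_step E h -> exists M, forall z, cabs (h z) <= M.
Proof.
move=> mh; exists (\sum_(v <- values h) cabs v) => z.
rewrite (bigD1_seq (h z)) ?values_uniq ?(values_mem z mh) //= lerDl.
by apply: sumr_ge0 => v _; exact: cabs_ge0.
Qed.

End Norms.

Section StepBounds.
Variables (R : realType) (H : completeNormedModType R[i]).
Variables (ip : {dot H for Num.conj}) (ipE : hilbert_form ip).
Variables (Omega : Type) (E : set (set Omega)) (Q : set Omega -> H -> H).
Hypothesis Esigma : sigma_algebra setT E.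
Hypothesis QP : forall A, E A -> oproj ip (Q A).
Hypothesis QT : forall x, Q setT x = x.
Hypothesis QU : forall A B, E A -> E B -> (forall z, A z -> B z -> False) ->
  forall x, Q (A `|` B) x = Q A x + Q B x.
Implicit Types (x y : H) (h : Omega -> R[i]^o).
Local Notation rip := (rip ip).

Lemma stepint_bounded h : measurable_step E h -> bounded_op (stepint Q h).
Proof.
move=> mh; have [_ Eh] := mh; rewrite /stepint; elim: (values h) => [|v s IH].
  by under eq_fun do rewrite big_nil; exact: bounded_op0.
under eq_fun do rewrite big_cons; apply: bounded_opD => //.
by apply: bounded_opZ; apply: (oproj_bounded ipE); exact: QP.
Qed.

Lemma stepint_comm h T x : measurable_step E h -> linear T ->
  (forall A, E A -> comm T (Q A)) -> T (stepint Q h x) = stepint Q h (T x).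
Proof.
move=> mh lT TQ; rewrite /stepint (linop_sum lT); apply: eq_bigr => v _.
by rewrite (linopZ lT) TQ //; case: mh.
Qed.

Lemma step_parseval h x : measurable_step E h ->
  nm x ^+ 2 = \sum_(v <- values h) nm (Q (h @^-1` [set v]) x) ^+ 2.
Proof.
move=> mh; rewrite (nm2 ipE).
transitivity (rip (\sum_(v <- values h) Q (h @^-1` [set v]) x) x).
  by rewrite (proj_cover Esigma QT QU x mh).
rewrite rip_suml; apply: eq_bigr => v _.
by rewrite (oproj_rip ipE) //; apply: QP; case: mh.
Qed.

End StepBounds.

Section SpectralIntegral.
Variables (R : realType) (H : completeNormedModType R[i]).
Variables (ip : {dot H for Num.conj}) (ipE : hilbert_form ip).
Variables (b c : H -> H).
Hypotheses (bb : bounded_op b) (bc : bounded_op c) (abc : adj ip b c).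
Hypothesis cbc : comm c b.
Hypothesis H_neq0 : exists x : H, x != 0.
Local Notation C := (R[i]^o).
Local Notation Om := (spectrum b).
Implicit Types (x y : H) (A B : set Om) (h : Om -> C).
Local Notation rip := (rip ip).
Local Notation specsub := (specsub ip b).
Local Notation innersub := (innersub ip b).
Local Notation borel := (@borel Om).
Local Notation P := (spectral_proj ip (b := b)).
Local Notation idOm := (fun z : Om => (set_val z : C)).

Let linb : linear b := bounded_linear bb.
Let Bs := borel_sigma b.
Let PP A (_ : borel A) := spectral_proj_oproj ipE A.
Let PT := spectral_projT ipE bb bc abc cbc.
Let PU := spectral_projU ipE bb bc abc cbc.

Lemma id_sub_bounded h : measurable_step borel h ->
  exists M, forall z, cabs ((idOm - h) z) <= M.
Proof.
move=> /mstep_bounded[M hM].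
have [r rb] := spectrum_bounded ipE bb bc abc cbc; exists (r + M) => z.
apply: le_trans (cabsD _ _) _; apply: lerD; last by rewrite cabsN.
by have := rb _ (set_valP z); rewrite /cdisc /= subr0.
Qed.

Lemma id_bounded_measurable : bounded_measurable borel idOm.
Proof.
split; last by move=> U oU; apply: borel_open; exact: sub_open_pre.
have [r rb] := spectrum_bounded ipE bb bc abc cbc.
exists r%:C; split; first by rewrite complex_real.
move=> y ry z _; apply: le_trans (ltW ry).
have := rb _ (set_valP z); rewrite /cdisc /= subr0 => zr.
by rewrite [ `|_| ](cabsE (set_val z)) lecR.
Qed.

Lemma Om_neq0 : [set: Om] !=set0.
Proof.
have [w wb] := spectrum_neq0 ipE bb bc abc cbc H_neq0.
by have [z _] := sub_point wb; exists z.
Qed.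

(** On the level set [h = v] the operator [b - v] is bounded by [sup |id - h|], and the
    subspaces of different level sets are orthogonal. *)
Lemma spectral_proj_integral : is_spectral_integral borel P idOm b.
Proof.
split; [exact: id_bounded_measurable|by []|].
exists (stepint P); first split.
- by move=> A mA; apply/funext => x; apply: (stepint_indic ipE Bs PP PT PU).
- move=> a h k mh mk; apply/funext => x.
  exact: (stepint_lin ipE Bs PP PT PU).
move=> h mh; have [M hM] := id_sub_bounded mh; have [_ Eh] := mh.
have [lI _] := (bounded_opE _).1 (stepint_bounded ipE PP mh).
set r := supnorm _.
have zr z : cabs (set_val z - h z) <= r by exact: (supnorm_ge z hM).
have r0 : 0 <= r by have [z _] := Om_neq0; exact: le_trans (cabs_ge0 _) (zr z).
apply: opnorm_le => // [a x y|x].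
  rewrite -[LHS]/(b (a *: x + y) - stepint P h (a *: x + y)) linb lI.
  by rewrite scalerBr opprD addrACA.
rewrite -[X in nm X]/(b x - stepint P h x).
rewrite -ler_sqr ?nnegrE ?nm_ge0 ?mulr_ge0 ?nm_ge0 // exprMn.
rewrite !(step_parseval ipE Bs PP PT PU _ mh) mulr_sumr; apply: ler_sum => v _.
set A := h @^-1` [set v]; have mA : borel A by exact: Eh.
have lA := oproj_lin (PP mA).
rewrite -exprMn ler_sqr ?nnegrE ?nm_ge0 ?mulr_ge0 ?nm_ge0 //.
rewrite (linopB lA) (stepint_local ipE Bs PP PT PU (d := v)) //.
rewrite (_ : P A (b x) = b (P A x)); last exact: (specproj_b ipE bb bc abc cbc).
apply: (innersub_bound ipE bb bc abc cbc (A := set_val @` A)) => //.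
  by move=> _ [z <- <-]; exact: zr.
exact: specproj_in.
Qed.

(** The consequence of norm integrability that is used: [b] is a norm limit of step
    integrals. *)
Lemma integral_approx (Q : set Om -> H -> H) (e : R) :
  (forall A, borel A -> oproj ip (Q A)) -> (forall x, Q setT x = x) ->
  (forall A B, borel A -> borel B -> (forall z, A z -> B z -> False) ->
    forall x, Q (A `|` B) x = Q A x + Q B x) ->
  is_spectral_integral borel Q idOm b -> 0 < e ->
  exists h, [/\ measurable_step borel h, (forall z, cabs (h z - set_val z) <= e) &
    forall x, nm (b x - stepint Q h x) <= e * nm x].
Proof.
move=> QP QT QU [_ _ [I sI bI]] e0.
have [h mh hz] := step_approx ipE bb bc abc cbc e0; exists h; split=> // x.
have := bI h mh; rewrite (step_integral_uniq Bs QU sI mh) => bh.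
have [lQ _] := (bounded_opE _).1 (stepint_bounded ipE QP mh).
have [lD [k k0 kD]] := (bounded_opE _).1
  (bounded_opD bb (bounded_opN (stepint_bounded ipE QP mh))).
have := opnorm_bound x lD kD => hx; apply: le_trans hx _.
rewrite ler_wpM2r ?nm_ge0 //; apply: le_trans bh _.
by apply: supnorm_le Om_neq0 _ => z; rewrite -cabsN opprB; exact: hz.
Qed.

Lemma integral_comm (Q : set Om -> H -> H) T :
  (forall A, borel A -> oproj ip (Q A)) -> (forall x, Q setT x = x) ->
  (forall A B, borel A -> borel B -> (forall z, A z -> B z -> False) ->
    forall x, Q (A `|` B) x = Q A x + Q B x) ->
  is_spectral_integral borel Q idOm b -> bounded_op T ->
  (forall A, borel A -> comm T (Q A)) -> comm T b.
Proof.
move=> QP QT QU iQ /bounded_opE[lT [k k0 kT]] TQ x.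
apply/eqP; rewrite -subr_eq0; apply/eqP.
apply: (@nm_scaled_small _ _ _ (2 * (k * nm x))) => e e0.
have [h [mh _ bh]] := integral_approx QP QT QU iQ e0.
have -> : T (b x) - b (T x) =
    T (b x - stepint Q h x) - (b (T x) - stepint Q h (T x)).
  by rewrite (linopB lT) (stepint_comm x mh lT TQ) opprB addrA subrK.
apply: le_trans (nmD _ _) _; rewrite nmN.
have h1 := kT (b x - stepint Q h x); have h2 := ler_wpM2l k0 (bh x).
have h3 := bh (T x); have h4 := ler_wpM2l (ltW e0) (kT x); lra.
Qed.

(** This is Fuglede's theorem in disguise: [T] preserves the spectral subspaces of a set
    and of its complement. *)
Lemma commutant_proj T A : bounded_op T -> comm T b -> borel A -> comm T (P A).
Proof.
move=> bT Tb mA x; have lT : linear T by case: bT.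
have sA := splitting_borel ipE bb bc abc cbc mA.
have lP := oproj_lin (PP mA).
have xE := splitting_sum ipE bb bc abc cbc x sA.
have inv F y : innersub F y -> innersub F (T y).
  exact: (innersub_inv ipE bb bc abc cbc).
rewrite {2}xE (linopD lT) (linopD lP) [X in _ = X + _](specproj_id ipE); last first.
  by apply: inv; exact: specproj_in.
rewrite [X in _ = _ + X](specproj_eq0 ipE) ?addr0 // => v Av.
apply: (innersub_orth ipE bb bc abc cbc _ (inv _ _ (specproj_in ipE b _ x)) Av).
by move=> z.
Qed.

Lemma spectral_commutantE : commutant b = spectral_commutant borel P.
Proof.
apply/seteqP; split=> T [bT]; [move=> /commE Tb|move=> TP]; split=> //.
  by move=> A mA; apply/commE; exact: commutant_proj.
apply/commE; apply: (integral_comm (Q := P)) => //; first exact: spectral_proj_integral.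
by move=> A /TP /commE.
Qed.

End SpectralIntegral.

(** * Uniqueness *)

Section Uniqueness.
Variables (R : realType) (H : completeNormedModType R[i]).
Variables (ip : {dot H for Num.conj}) (ipE : hilbert_form ip).
Variables (b c : H -> H).
Hypotheses (bb : bounded_op b) (bc : bounded_op c) (abc : adj ip b c).
Hypothesis cbc : comm c b.
Hypothesis H_neq0 : exists x : H, x != 0.
Local Notation C := (R[i]^o).
Local Notation Om := (spectrum b).
Implicit Types (x y : H) (A B : set Om) (h : Om -> C).
Local Notation rip := (rip ip).
Local Notation specsub := (specsub ip b).
Local Notation innersub := (innersub ip b).
Local Notation borel := (@borel Om).
Local Notation P := (spectral_proj ip (b := b)).
Local Notation idOm := (fun z : Om => (set_val z : C)).
Variable Q : set Om -> H -> H.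
Hypothesis Qres : resolution_of_identity ip Q.
Hypothesis Qint : is_spectral_integral borel Q idOm b.

Let linb : linear b := bounded_linear bb.
Let Bs := borel_sigma b.

Let QP A : borel A -> oproj ip (Q A).
Proof. by case: Qres => _ _ [_ _ h _ _] _ /h /(oprojE ipE). Qed.

Let QT x : Q setT x = x.
Proof. by case: Qres => _ _ [_ _ _ -> _] _. Qed.

Let QU A B : borel A -> borel B -> (forall z, A z -> B z -> False) ->
  forall x, Q (A `|` B) x = Q A x + Q B x.
Proof.
move=> mA mB AB x; have mAB := measU Bs mA mB.
case: Qint => _ _ [I [I1 IL] _].
have <- := I1 _ mA; have <- := I1 _ mB; have <- := I1 _ mAB.
have := IL 1 \1_A \1_B (mstep_indic R Bs mA) (mstep_indic R Bs mB).
rewrite !scale1r => IAB.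
rewrite -[RHS]/((I \1_A + I \1_B) x) -IAB; congr (I _ x).
apply/funext => z; rewrite -[RHS]/(\1_A z + \1_B z) !indicE.
have [Az|nAz] := pselect (A z); have [Bz|nBz] := pselect (B z).
- by case: (AB z).
- by rewrite (mem_set Az) (memNset nBz) mem_set ?addr0 //; left.
- by rewrite (mem_set Bz) (memNset nAz) mem_set ?add0r //; right.
- by rewrite (memNset nAz) (memNset nBz) memNset ?addr0 //; case.
Qed.

Let Q_comm_b A : borel A -> comm (Q A) b.
Proof.
move=> mA; apply: (integral_comm ipE bb bc abc cbc H_neq0 QP QT QU Qint).
  exact: (oproj_bounded ipE (QP mA)).
by move=> B mB x; exact: (proj_comm ipE Bs QP QU).
Qed.

(** The projections [Q] of small pieces of [L] are localised near [L], hence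
    killed by every projection localised off [L]. *)
Lemma range_specsub (L : set Om) x : compact L -> borel L ->
  specsub (set_val @` L) (Q L x).
Proof.
move=> cL mL z e p zp e0 Le; have [pP pb pe] := zp.
have cvL : closed (set_val @` L : set C).
  by apply: compactC_closed; exact: sub_compact_image.
have [d d0 dP] : exists2 d, 0 < d & forall w k l (v : C), cdisc z e k ->
    (set_val @` L : set C) l -> setT v ->
    cabs (k - w) <= d -> cabs (l - w) <= d -> cabs (v - w) <= d -> False.
  apply: fine_scale => //; first exact: cdisc_compact.
  by move=> w zw /Le + _; rewrite ltNge => /negP; apply; exact: zw.
have [h [mh hz bh]] := integral_approx ipE bb bc abc cbc H_neq0 QP QT QU Qint d0.
have [_ Eh] := mh; have lp := oproj_lin pP.
set y := Q L x.
rewrite -(proj_cover Bs QT QU y mh) (linop_sum lp) big1 // => v _.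
set A := h @^-1` [set v]; have mA : borel A by exact: Eh.
have vQ : localized ip b v d (Q A).
  split; [exact: QP|exact: Q_comm_b|move=> u].
  have := bh (Q A u); suff -> : stepint Q h (Q A u) = v *: Q A u by [].
  rewrite -(stepint_comm u mh (oproj_lin (QP mA))) => [|B mB w].
    by rewrite (stepint_local ipE Bs QP QT QU (d := v)).
  exact: (proj_comm ipE Bs QP QU).
have [[z' [Az Lz]]|AL] := pselect (exists z', A z' /\ L z'); last first.
  rewrite /y (projI ipE Bs QP QU) // (_ : A `&` L = set0).
    by rewrite (proj0 Bs QU) (linop0 lp).
  by apply/seteqP; split=> // z' [Az' Lz']; apply: AL; exists z'.
have zv : cabs (set_val z' - v) <= d by rewrite cabsC -Az; exact: hz.
apply: (@separation _ _ _ ipE _ _ _ _ _ _ _ (fun x => x) vQ zp) => //.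
- exact: bounded_op_id.
- exact: ltW.
rewrite ltNge; apply/negP => vz.
have [k kz kv] : exists2 k, cabs (k - z) <= e & cabs (k - v) <= d.
  by apply: segment_point; rewrite ?(ltW d0) // cabsC [e + d]addrC.
apply: (dP v k (set_val z') v) => //.
by rewrite subrr cabs0 ltW.
Qed.

Lemma compact_borel (K : set Om) : compact K -> borel K.
Proof.
move=> cK; rewrite -[K]setCK; apply: (measC Bs); apply: borel_open.
by apply: closed_openC; apply: compact_closed cK; exact: sub_hausdorff.
Qed.

(** Inner regularity of [Q] reduces this to compact sets. *)
Lemma range_innersub A x : borel A -> innersub (set_val @` A) (Q A x).
Proof.
move=> mA e e0; have e2 : 0 < e ^+ 2 by rewrite exprn_gt0.
have qE B : borel B -> spectral_value ip Q x B = (nm (Q B x) ^+ 2)%:E.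
  by move=> mB; rewrite /spectral_value -(oproj_rip ipE (QP mB)).
case: Qres => _ _ _ /(_ x A mA) reg.
have fin : ereal_sup [set spectral_value ip Q x K |
    K in [set K | K `<=` A /\ compact K]] \is a fin_num by rewrite -reg qE.
have [_ [K [KA cK] <-]] := ub_ereal_sup_adherent e2 fin.
have mK := compact_borel cK.
rewrite -reg !qE // -EFinB lte_fin => AK.
exists (set_val @` K); split.
- exact: sub_compact_image.
- exact: image_subset.
exists (Q K x); first exact: range_specsub.
have -> : Q K x = Q K (Q A x) by rewrite (projI ipE Bs QP QU) // setIidl.
rewrite -ltr_sqr ?nnegrE ?nm_ge0 ?(ltW e0) //.
have := oproj_pyth ipE (QP mK) (Q A x).
rewrite {1}(projI ipE Bs QP QU) // setIidl //; lra.
Qed.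

(** [P A] is the identity on the spectral subspace of [A] and vanishes on that of the
    complement, which contain the ranges of [Q A] and [Q (~` A)]. *)
Lemma resolution_uniq A : borel A -> Q A = P A.
Proof.
move=> mA; apply/funext => x; have mC := measC Bs mA.
have xE : x = Q A x + Q (~` A) x.
  by rewrite -QU // ?setUv ?QT // => z Az; apply.
have lP := oproj_lin (spectral_proj_oproj ipE A).
rewrite [in RHS]xE (linopD lP) [X in _ = X + _](specproj_id ipE); last first.
  exact: range_innersub.
rewrite [X in _ = _ + X](specproj_eq0 ipE) ?addr0 // => v Av.
apply: (innersub_orth ipE bb bc abc cbc _ (range_innersub x mC) Av).
by move=> _ [z nAz <-] [z' Az' /set_val_inj zz]; rewrite zz in Az'.
Qed.

End Uniqueness.

Theorem theorem35p5 (R : realType) (H : completeNormedModType R[i])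
    (ip : {dot H for Num.conj}) (ipE : hilbert_form ip)
    (H_neq0 : exists x : H, x != 0)
    (b : H -> H) (b_bounded : bounded_op b) (b_normal : normal_op ip b) :
  exists P : set (spectrum b) -> H -> H,
    [/\ resolution_of_identity ip P,
        is_spectral_integral (@borel (spectrum b)) P
          (fun z : spectrum b => set_val z) b,
        (forall Q : set (spectrum b) -> H -> H,
          resolution_of_identity ip Q ->
          is_spectral_integral (@borel (spectrum b)) Q
            (fun z : spectrum b => set_val z) b ->
          forall A : set (spectrum b), borel A -> Q A = P A),
        commutant b = spectral_commutant (@borel (spectrum b)) P &
        is_support P setT].
Proof.
have [c [bc bc_adjoint /commE cbc]] := b_normal.
have abc : adj ip b c by apply/adj_is_adjoint => //; case: b_bounded.
exists (spectral_proj ip (b := b)); split.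
- exact: (spectral_resolution ipE b_bounded bc abc cbc).
- exact: (spectral_proj_integral ipE b_bounded bc abc cbc H_neq0).
- move=> Q Qres Qint A mA.
  exact: (resolution_uniq ipE b_bounded bc abc cbc H_neq0 Qres Qint).
- exact: (spectral_commutantE ipE b_bounded bc abc cbc H_neq0).
- exact: (spectral_support ipE b_bounded bc abc cbc).
Qed.
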